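(* Let $\Delta=\Delta(X,Y,T,E)$ be a tableau complex homeomorphic to a ball or a sphere, let $\mathbb{k}$ be a field and $S=\mathbb{k}[V]$ with $V=\{v_{(x,y)}:(x,y)\in E\}$. Then \[K(S/I_\Delta;\mathbf t)=\sum_F(-1)^{|F|-|X|}\prod_{x\in X}\prod_{y\in F(x)}\big(1-t_{v_{(x,y)}}\big),\] the sum over all set-valued tableaux $F\subseteq E$ with $F(x)\neq\varnothing$ for every $x\in X$ such that every tableau $f\subseteq F$ lies in $T$; here $|F|=\sum_{x\in X}|F(x)|$.
   Context: Let $X,Y$ be finite sets; a tableau is a function $f:X\to Y$ identified with its graph in $X\times Y$; a set-valued tableau is $F\subseteq X\times Y$ with $F(x)=\{y:(x,y)\in F\}$, and $f\subseteq F$ means $f(x)\in F(x)$ for all $x$. Let $T$ be a set of tableaux and $E\subseteq X\times Y$ contain every $f\in T$; put $v_{(x,y)}:=E\setminus\{(x,y)\}$. The tableau complex $\Delta(X,Y,T,E)$ is the simplicial complex on ground set $V$ whose faces are the sets $\{v_{(x,y)}:(x,y)\in E\setminus F\}$ for $F\subseteq E$ containing some $f\in T$. The Stanley–Reisner ideal $I_\Delta\subseteq S$ is generated by the monomials $\prod_{v\in G}v$ for $G\subseteq V$ not a face. With the $\mathbb Z^V$-grading (variable $v$ of degree $t_v$), $K(S/I_\Delta;\mathbf t)$ is the numerator of the Hilbert series of $S/I_\Delta$ over $\prod_{v\in V}(1-t_v)$. *)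

(* Defs.v *)
From HB Require Import structures.
From mathcomp Require Import all_boot all_order all_algebra.
From mathcomp Require Import mpoly.
From mathcomp Require Import classical_sets reals topology.

Set Implicit Arguments.
Unset Strict Implicit.
Unset Printing Implicit Defensive.

Import GRing.Theory Num.Theory.
Import numFieldTopology.Exports.

Local Open Scope ring_scope.

(* The polynomial ring A[V]: the variable attached to v : V is
   'X_(enum_rank v), and a multidegree in N^V is an 'X_{1..#|V|}. *)
Notation polyring A V := {mpoly A[#|V|]}.

Definition var (A : nzRingType) (V : finType) (v : V) : polyring A V :=
  'X_(enum_rank v).

Section StanleyReisner.
Variables (k : fieldType) (V : finType).

Definition stanley_reisner_ideal (D : {set {set V}}) (p : polyring k V) : Prop :=
  exists c : {set V} -> polyring k V,
    p = \sum_(G : {set V} | G \notin D) c G * \prod_(v in G) var k v.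

Definition graded_piece (a : 'X_{1..#|V|}) (p : polyring k V) : Prop :=
  exists c : k, p = c *: 'X_[a].

(* The image of the subspace W in M / J has a basis with d elements. *)
Definition has_dim_mod (M : lmodType k) (W J : M -> Prop) (d : nat) : Prop :=
  exists b : 'I_d -> M,
    [/\ forall i, W (b i),
        forall c : 'I_d -> k, J (\sum_i c i *: b i) -> forall i, c i = 0
      & forall w, W w -> exists c : 'I_d -> k, J (w - \sum_i c i *: b i)].

Definition is_hilbert_function (J : polyring k V -> Prop)
    (h : 'X_{1..#|V|} -> nat) : Prop :=
  forall a, has_dim_mod (graded_piece a) J (h a).

(* Cauchy product in Z[[t_v : v in V]], a power series being given by its
   coefficients. *)
Definition series_mul (f g : 'X_{1..#|V|} -> int) (m : 'X_{1..#|V|}) : int :=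
  \sum_(c : 'X_{1..#|V| < (mdeg m).+1, (mdeg m).+1} | m == (c.1 + c.2)%MM)
    f c.1 * g c.2.

(* K is the numerator of the Hilbert series of k[V]/J over
   \prod_v (1 - t_v), i.e. Hilb(k[V]/J; t) * \prod_v (1 - t_v) = K. *)
Definition is_K_polynomial (J : polyring k V -> Prop)
    (K : polyring int V) : Prop :=
  exists2 h, is_hilbert_function J h &
    forall m, series_mul (fun a => (h a)%:Z)
                (fun a => (\prod_(v : V) (1 - var int v))@_a) m = K@_m.

End StanleyReisner.

Section Topology.
Local Open Scope classical_set_scope.

(* Barycentric coordinates; the support of a point must be a face. *)
Definition realization (R : realType) (V : finType) (D : {set {set V}}) :
    set 'rV[R]_#|V| :=
  [set p | [/\ forall i, 0 <= p ord0 i, \sum_i p ord0 i = 1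
             & finset (fun v => p ord0 (enum_rank v) != 0) \in D]].

Definition unit_ball (R : realType) (d : nat) : set 'rV[R]_d :=
  [set p | \sum_i p ord0 i ^+ 2 <= 1].

(* The (d-1)-dimensional sphere; it is empty for d = 0. *)
Definition unit_sphere (R : realType) (d : nat) : set 'rV[R]_d :=
  [set p | \sum_i p ord0 i ^+ 2 = 1].

Arguments realization R {V} D.
Arguments unit_ball R d : clear implicits.
Arguments unit_sphere R d : clear implicits.

Definition homeomorphic (S T : topologicalType) (A : set S) (B : set T) : Prop :=
  exists (f : S -> T) (g : T -> S),
    [/\ {within A, continuous f}, {within B, continuous g},
        forall x, A x -> B (f x), forall y, B y -> A (g y)
      & (forall x, A x -> g (f x) = x) /\ (forall y, B y -> f (g y) = y)].

Definition is_ball_or_sphere (R : realType) (V : finType)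
    (D : {set {set V}}) : Prop :=
  (exists d, homeomorphic (realization R D) (unit_ball R d)) \/
  (exists d, homeomorphic (realization R D) (unit_sphere R d)).

End Topology.

Section Tableaux.
Variables X Y : finType.
Implicit Types (f : {ffun X -> Y}) (F E : {set X * Y}) (T : {set {ffun X -> Y}}).

Definition graph f : {set X * Y} := [set (x, f x) | x : X].

Definition entries F (x : X) : {set Y} := [set y | (x, y) \in F].

(* The ground set {E \ {(x,y)} : (x,y) in E}. *)
Definition vertex E : finType :=
  {v : {set X * Y} | v \in [set E :\ e | e in E]}.

Definition tableau_complex T E : {set {set vertex E}} :=
  [set [set v : vertex E | val v \in [set E :\ e | e in E :\: F]]
     | F in [set F : {set X * Y} | (F \subset E)
                                     && [exists f in T, graph f \subset F]]].

(* The variable t_{v_{(x,y)}}, with the dummy value 0 when (x,y) is not in E. *)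
Definition tvar E (e : X * Y) : polyring int (vertex E) :=
  if insub (E :\ e) is Some v then var int (v : vertex E) else 0.

End Tableaux.

(* Main.v *)
From HB Require Import structures.
Require Import Defs.
From mathcomp Require Import mpoly.
From mathcomp Require Import classical_sets boolp reals topology normedtype sequences.
From mathcomp Require Import ring lra.
(* Last, so that [set0], [subsetP], ... are those of finite sets. *)
From mathcomp Require Import all_boot all_order all_algebra.

(** Expanding the Hilbert series face by face and substituting [u = 1 - t], the
    coefficient of [\prod_(v in F) u_v] in the K-polynomial is the alternating
    sum [link_euler] of the faces containing the complement of [F].  If every
    tableau in [F] lies in [T], this sum factors over the rows of [F] and is the
    sign of the theorem; if no tableau in [F] lies in [T], it is empty.

    In the mixed case two tableaux in [F], one in [T] and one not, differ in a
    single entry and give a face contained in a single facet; it lies above the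
    face [s] complementary to [F].  This forces [s] onto the boundary of the ball,
    as follows.  Call a space null-punctured at [p] if small punctured
    neighbourhoods of [p] contract inside larger ones.  A ball is null-punctured
    at its boundary points, while its interior points, and likewise the points of
    a sphere, all behave alike.  If a complex is null-punctured at [p], radial
    projection makes the sphere of directions at [p] contractible, so the
    alternating sum at the support of [p] vanishes.  Hence points inside a facet
    are not null-punctured, whereas points of a free face are, and by closedness
    the points of [s] are too.

    Contractible complexes have alternating sum zero because labelling a fine
    subdivision by the largest barycentric coordinate turns the contraction into
    a sequence of contiguous simplicial maps.  All chain homotopies involved,
    and the subdivision itself, are obtained from acyclic carriers over [F_2]. *)

Set Implicit Arguments.
Unset Strict Implicit.
Unset Printing Implicit Defensive.

Import GRing.Theory Num.Theory Order.TTheory.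
Import numFieldTopology.Exports numFieldNormedType.Exports.

Local Open Scope ring_scope.

(** * Chains modulo 2 *)

Definition simplicial_complex (V : finType) (D : {set {set V}}) :=
  forall A B : {set V}, A \in D -> B \subset A -> B \in D.

Lemma setD1_ind (V : finType) (P : {set V} -> Prop) :
  (forall A : {set V}, (forall a, a \in A -> P (A :\ a)) -> P A) ->
  forall A, P A.
Proof.
move=> PD1 A; have [n] := ubnP #|A|.
elim: n A => // n IHn A leAn; apply: PD1 => a aA; apply: IHn.
by rewrite (cardsD1 a) aA in leAn.
Qed.

Lemma setU1_ind (V : finType) (P : {set V} -> Prop) :
  P set0 -> (forall a (A : {set V}), a \notin A -> P A -> P (a |: A)) ->
  forall A, P A.
Proof.
move=> P0 PU1; elim/setD1_ind => A PD1.
have [->//|/set0Pn[a aA]] := eqVneq A set0.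
by rewrite -(setD1K aA); apply: PU1; rewrite ?setD11 //; apply: PD1.
Qed.

Lemma setU1_neq0 (V : finType) (v : V) (A : {set V}) : v |: A != set0.
Proof. by apply/set0Pn; exists v; rewrite setU11. Qed.

Notation chain V := {ffun {set V} -> ('F_2)^o}.

Lemma addrr_chain (V : finType) (c : chain V) : c + c = 0.
Proof. by apply/ffunP=> A; rewrite !ffunE [LHS](@addrr_pchar2 'F_2) ?pchar_Fp. Qed.

Section Chains.
Variable V : finType.
Implicit Types (v w : V) (A B : {set V}) (S : {set {set V}}) (c d : chain V).

Definition simplex A : chain V := [ffun B => (A == B)%:R].

Definition cone w c : chain V :=
  [ffun B : {set V} => if w \in B then c (B :\ w) else 0].

Definition boundary c : chain V :=
  [ffun B : {set V} => \sum_(a | a \notin B) c (a |: B)].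

Lemma chain_sum c : c = \sum_A c A *: simplex A.
Proof.
apply/ffunP=> B; rewrite sum_ffunE (bigD1 B) //= big1 => [|A AB].
  by rewrite addr0 !ffunE eqxx -[RHS]/(_ * _) mulr1.
by rewrite !ffunE (negbTE AB) scaler0.
Qed.

Lemma cone_is_linear w : linear (cone w).
Proof.
by move=> x c d; apply/ffunP=> B; rewrite !ffunE; case: ifP; rewrite ?scaler0 ?addr0.
Qed.
HB.instance Definition _ w :=
  GRing.isLinear.Build 'F_2 (chain V) (chain V) *:%R (cone w) (cone_is_linear w).

Lemma boundary_is_linear : linear boundary.
Proof.
move=> x c d; apply/ffunP=> B; rewrite !ffunE scaler_sumr -big_split /=.
by apply: eq_bigr => a _; rewrite !ffunE.
Qed.
HB.instance Definition _ :=
  GRing.isLinear.Build 'F_2 (chain V) (chain V) *:%R boundary boundary_is_linear.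

Lemma cone_simplex w A : w \notin A -> cone w (simplex A) = simplex (w |: A).
Proof.
move=> wA; apply/ffunP=> B; rewrite !ffunE.
case: ifP => wB; last by case: eqP => // AB; rewrite -AB setU11 in wB.
congr (nat_of_bool _)%:R; apply/eqP/eqP => [->|<-]; first by rewrite setD1K.
by rewrite setU1K.
Qed.

Lemma boundary_cone w c : boundary (cone w c) = c + cone w (boundary c).
Proof.
apply/ffunP=> B; rewrite !ffunE; case: ifP => wB; last first.
  rewrite addr0 (bigD1 w) ?wB //= ffunE setU11 setU1K ?wB // big1 ?addr0 //.
  by move=> a /andP[aB aw]; rewrite ffunE !inE wB eq_sym (negbTE aw).
rewrite [in RHS](bigD1 w) ?setD11 //= setD1K // addrA.
rewrite [c B + _](@addrr_pchar2 'F_2) ?pchar_Fp // add0r.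
apply: eq_big => [a|a aB]; first by rewrite !inE; case: eqP => [->|]; rewrite ?wB ?andbT.
rewrite ffunE !inE wB orbT; congr (c _); apply/setP=> b; rewrite !inE.
have aw : a != w by apply: contraNneq aB => ->.
by case: (b =P a) => [->|] //=; rewrite aw.
Qed.

Lemma boundary_simplex A : boundary (simplex A) = \sum_(a in A) simplex (A :\ a).
Proof.
apply/ffunP=> B; rewrite ffunE sum_ffunE big_mkcond [RHS]big_mkcond /=.
apply: eq_bigr => a _; rewrite !ffunE; case: ifPn => aB; case: ifPn => // aA.
- by congr (nat_of_bool _)%:R; apply/eqP/eqP => [->|<-]; rewrite ?setU1K ?setD1K.
- by case: eqP => // AB; rewrite AB setU11 in aA.
- by case: eqP => // AB; rewrite -AB setD11 in aB.
Qed.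

Lemma boundaryK c : boundary (boundary c) = 0.
Proof.
rewrite (chain_sum c) !linear_sum big1 //= => A _; rewrite !linearZ /=.
suff -> : boundary (boundary (simplex A)) = 0 by rewrite scaler0.
elim/setU1_ind: A => [|w A wA IHA].
  by rewrite boundary_simplex big_set0 linear0.
rewrite -cone_simplex // boundary_cone linearD /= boundary_cone IHA linear0 addr0.
exact: addrr_chain.
Qed.

Lemma span_simplex_support (s : seq {set V}) c B :
  c \in <<map simplex s>>%VS -> c B != 0 -> B \in s.
Proof.
set X := map _ _; rewrite -[X]/(tval (in_tuple X)) => /coord_span ->.
rewrite sum_ffunE; apply: contraNT => Bs; rewrite big1 // => i _.
have /mapP[A As ->] : (in_tuple X)`_i \in X by apply: mem_nth.
rewrite !ffunE; case: eqP => [AB|_]; last by rewrite scaler0.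
by rewrite -AB As in Bs.
Qed.

Lemma free_simplex (s : seq {set V}) : uniq s -> free (map simplex s).
Proof.
elim: s => [_|A s IHs /= /andP[As us]]; first by rewrite nil_free.
rewrite free_cons IHs // andbT; apply: contra As => /span_simplex_support; apply.
by rewrite ffunE eqxx.
Qed.

Definition chains (S : {set {set V}}) : {vspace chain V} :=
  <<map simplex (enum S)>>%VS.

Lemma chainsP S c : reflect (forall B, c B != 0 -> B \in S) (c \in chains S).
Proof.
apply: (iffP idP) => [cS B|cS].
  by move/(span_simplex_support cS); rewrite mem_enum.
rewrite (chain_sum c); apply: memv_suml => A _.
have [->|cA] := eqVneq (c A) 0; first by rewrite scale0r mem0v.
by apply/memvZ/memv_span/map_f; rewrite mem_enum cS.
Qed.

Lemma dim_chains S : \dim (chains S) = #|S|.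
Proof.
by have /eqP := free_simplex (enum_uniq S); rewrite size_map -cardE.
Qed.

Lemma mem_chains_simplex S A : (simplex A \in chains S) = (A \in S).
Proof.
apply/chainsP/idP => [/(_ A)|AS B]; first by rewrite ffunE eqxx => ->.
by rewrite ffunE; case: (A =P B) => [<-|]; rewrite ?eqxx.
Qed.

Lemma chainsS S S' : S \subset S' -> (chains S <= chains S')%VS.
Proof.
by move=> /subsetP SS'; apply/subvP=> c /chainsP cS; apply/chainsP=> B /cS /SS'.
Qed.

Lemma eq_linear_chains (U : lmodType 'F_2) (F G : {linear chain V -> U}) S :
  (forall A, A \in S -> F (simplex A) = G (simplex A)) ->
  forall c, c \in chains S -> F c = G c.
Proof.
move=> FG c /chainsP cS; rewrite (chain_sum c) !linear_sum; apply: eq_bigr => A _ /=.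
have [->|/cS/FG FGA] := eqVneq (c A) 0; first by rewrite !scale0r !linear0.
by rewrite !linearZ /= FGA.
Qed.

Lemma cone_chains S S' w c :
  (forall A, A \in S -> w |: A \in S') -> c \in chains S -> cone w c \in chains S'.
Proof.
move=> SS' /chainsP cS; apply/chainsP=> B; rewrite ffunE.
by case: ifP => [wB /cS/SS'|]; rewrite ?eqxx // setD1K.
Qed.

End Chains.

Section LinearExtension.
Variables W V : finType.
Implicit Types (f g : {set W} -> chain V) (A : {set W}) (M : {set {set W}}) (c : chain W).

Definition linext f c : chain V := \sum_A c A *: f A.

Lemma linext_is_linear f : linear (linext f).
Proof.
move=> x c d; rewrite /linext scaler_sumr -big_split /=; apply: eq_bigr => A _.
by rewrite !ffunE scalerDl scalerA.
Qed.
HB.instance Definition _ f :=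
  GRing.isLinear.Build 'F_2 (chain W) (chain V) *:%R (linext f) (linext_is_linear f).

Lemma linext_simplex f A : linext f (simplex A) = f A.
Proof.
rewrite /linext (bigD1 A) //= big1 => [|B BA]; first by rewrite !ffunE eqxx scale1r addr0.
by rewrite ffunE eq_sym (negbTE BA) scale0r.
Qed.

Lemma linext_boundary_simplex f A :
  linext f (boundary (simplex A)) = \sum_(a in A) f (A :\ a).
Proof.
by rewrite boundary_simplex linear_sum; apply: eq_bigr => a _; rewrite /= linext_simplex.
Qed.

Lemma linext_chains M L f c : (forall A, A \in M -> f A \in chains L) ->
  c \in chains M -> linext f c \in chains L.
Proof.
move=> fL /chainsP cM; apply: memv_suml => A _.
have [->|/cM/fL fA] := eqVneq (c A) 0; first by rewrite scale0r mem0v.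
exact: memvZ.
Qed.

Definition chain_map M f :=
  forall A, A \in M -> boundary (f A) = \sum_(a in A) f (A :\ a).

Lemma boundary_linext M f c : chain_map M f -> c \in chains M ->
  boundary (linext f c) = linext f (boundary c).
Proof.
move=> fM cM.
pose F := @boundary V \o linext f; pose G := linext f \o @boundary W.
apply: (eq_linear_chains (F := F) (G := G)) cM => A AM /=.
by rewrite linext_simplex fM // linext_boundary_simplex.
Qed.

End LinearExtension.

Lemma simplex_chain_map (V : finType) (M : {set {set V}}) : chain_map M (@simplex V).
Proof. by move=> A _; apply: boundary_simplex. Qed.

Lemma chain_map_comp (U W V : finType) (L : {set {set U}}) (M : {set {set W}})
    (s : {set U} -> chain W) (f : {set W} -> chain V) :
  chain_map L s -> (forall A, A \in L -> s A \in chains M) -> chain_map M f ->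
  chain_map L (fun A => linext f (s A)).
Proof.
move=> sL sM fM A AL; rewrite (boundary_linext fM) ?sM // sL // linear_sum.
by apply: eq_bigr.
Qed.

Section AcyclicCarrier.
Variables (W V : finType) (M : {set {set W}}) (carrier : {set W} -> {set {set V}}).
Variables (f : {set W} -> chain V) (c0 : chain V).
Implicit Types A B : {set W}.

Definition cone_point A v := [forall (B | B \in carrier A), v |: B \in carrier A].

Fixpoint cone_extension n A : chain V :=
  if n is n'.+1 then
    if [pick v | cone_point A v] is Some v
    then cone v (f A + \sum_(a in A) cone_extension n' (A :\ a)) else c0
  else c0.

Hypotheses (Mcomplex : simplicial_complex M) (f_chain_map : chain_map M f).
Hypothesis carrierS : forall A B, A \in M -> B \subset A -> carrier B \subset carrier A.
Hypothesis carrier_cone : forall A, A \in M -> A != set0 -> exists v, cone_point A v.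
Hypothesis f_carrier : forall A, A \in M -> f A \in chains (carrier A).
Hypothesis c0_carrier : c0 \in chains (carrier set0).
Hypothesis boundary_c0 : boundary c0 = f set0.

(* A cycle [z] with a cone point [v] is the boundary of [cone v z]; so the values
   of the extension can be chosen by induction on the simplex. *)
Lemma acyclic_carrier : exists X : {set W} -> chain V,
  [/\ X set0 = c0, forall A, A \in M -> X A \in chains (carrier A)
    & forall A, A \in M -> boundary (X A) = f A + \sum_(a in A) X (A :\ a)].
Proof.
pose X A := cone_extension #|A| A.
have X0 : X set0 = c0 by rewrite /X cards0.
have XE A : A \in M -> A != set0 -> exists2 v, cone_point A v
    & X A = cone v (f A + \sum_(a in A) X (A :\ a)).
  move=> AM A0; have [v Av] := carrier_cone AM A0.
  move: A0; rewrite -card_gt0 {1}/X; case cA: #|A| => [//|n] _ /=.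
  case: pickP => [u Au|/(_ v)]; last by rewrite Av.
  exists u => //; congr (cone _ (_ + _)); apply: eq_bigr => a aA.
  by move: cA; rewrite (cardsD1 a) aA add1n /X => -[<-].
have Xspec A : A \in M -> X A \in chains (carrier A) /\
    boundary (X A) = f A + \sum_(a in A) X (A :\ a).
  elim/setD1_ind: A => A IHA AM.
  have faceM a : A :\ a \in M by apply: Mcomplex AM (subD1set _ _).
  have [->|A0] := eqVneq A set0; first by rewrite X0 big_set0 addr0.
  have [v /forall_inP Av ->] := XE A AM A0; set z := f A + _.
  have zA : z \in chains (carrier A).
    apply: memvD (f_carrier AM) (memv_suml _ _) => a aA.
    have [Xa _] := IHA a aA (faceM a).
    exact: subvP (chainsS (carrierS AM (subD1set _ _))) _ Xa.
  split; first exact: cone_chains Av zA.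
  rewrite boundary_cone (_ : boundary z = 0) ?linear0 ?addr0 //.
  rewrite linearD linear_sum /= f_chain_map //.
  have -> : \sum_(a in A) boundary (X (A :\ a)) =
      \sum_(a in A) (f (A :\ a) + linext X (boundary (simplex (A :\ a)))).
    apply: eq_bigr => a aA; rewrite linext_boundary_simplex.
    by have [_ ->] := IHA a aA (faceM a).
  rewrite big_split addrA addrr_chain add0r -linear_sum -linear_sum /= -boundary_simplex.
  by rewrite boundaryK linear0.
by exists X; split=> // A /Xspec[].
Qed.

End AcyclicCarrier.

Section Homotopy.
Variables (W V : finType) (M : {set {set W}}) (L : {set {set V}}).
Implicit Types (f g h : {set W} -> chain V) (A B : {set W}).

Definition homotopic f g := exists2 D : {set W} -> chain V,
  forall A, A \in M -> D A \in chains L &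
  forall A, A \in M -> boundary (D A) + \sum_(a in A) D (A :\ a) = f A + g A.

Lemma homotopic_refl f : homotopic f f.
Proof.
exists (fun=> 0) => A _; first exact: mem0v.
by rewrite addrr_chain linear0 add0r big1.
Qed.

Lemma homotopic_trans f g h : homotopic f g -> homotopic g h -> homotopic f h.
Proof.
move=> [D DL Dfg] [D' D'L D'gh]; exists (fun A => D A + D' A) => A AM.
  by rewrite memvD ?DL ?D'L.
rewrite linearD big_split /= addrACA Dfg // D'gh // addrA -[_ + _ + g A]addrA.
by rewrite addrr_chain addr0.
Qed.

Hypotheses (Mcomplex : simplicial_complex M) (Lcomplex : simplicial_complex L).

Lemma carrier_homotopic f g (phi : {set W} -> {set V}) (c0 : chain V) :
  chain_map M f -> chain_map M g ->
  (forall A B, B \subset A -> phi B \subset phi A) ->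
  (forall A, A != set0 -> phi A != set0) ->
  (forall A, A \in M -> f A \in chains (powerset (phi A))) ->
  (forall A, A \in M -> g A \in chains (powerset (phi A))) ->
  c0 \in chains (powerset (phi set0)) -> boundary c0 = f set0 + g set0 ->
  (forall A, A \in M -> phi A \in L) -> homotopic f g.
Proof.
move=> fM gM phiS phi0 fphi gphi c0phi c0E phiL.
have fgM : chain_map M (fun A => f A + g A).
  by move=> A AM; rewrite linearD big_split /= fM // gM.
have [A B _ BA|A _ A0|A AM||//|D [_ Dphi DE]] :=
    acyclic_carrier (carrier := fun A => powerset (phi A)) (c0 := c0) Mcomplex fgM.
- by rewrite powersetS phiS.
- have /set0Pn[v vA] := phi0 A A0; exists v.
  by apply/forall_inP=> B; rewrite !powersetE subUset sub1set vA.
- by rewrite memvD ?fphi ?gphi.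
- exact: c0phi.
exists D => A AM; last by rewrite DE // -addrA addrr_chain addr0.
apply: subvP (Dphi A AM); apply: chainsS; apply/subsetP=> B; rewrite powersetE.
by apply: Lcomplex; apply: phiL.
Qed.

End Homotopy.

Lemma homotopic_comp (U W V : finType) (K : {set {set U}}) (M : {set {set W}})
    (L : {set {set V}}) (s : {set U} -> chain W) (f g : {set W} -> chain V) :
  simplicial_complex K -> simplicial_complex M ->
  chain_map K s -> (forall A, A \in K -> s A \in chains M) -> homotopic M L f g ->
  homotopic K L (fun A => linext f (s A)) (fun A => linext g (s A)).
Proof.
move=> Kcomplex Mcomplex sK sM [D DL DE]; exists (fun A => linext D (s A)) => A AK.
  by apply: linext_chains DL _; apply: sM.
rewrite -linear_sum /= -sK //.
pose F := (@boundary V \o linext D) \+ (linext D \o @boundary W).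
apply: (eq_linear_chains (F := F) (G := linext f \+ linext g)) (sM A AK) => B BM /=.
by rewrite !linext_simplex linext_boundary_simplex DE.
Qed.

Section EulerCharacteristic.
Variables (V : finType) (L : {set {set V}}).
Hypothesis Lcomplex : simplicial_complex L.
Implicit Types c : chain V.

Lemma homotopic_zero_cycle c : homotopic L L (@simplex V) (fun=> 0) ->
  c \in chains L -> boundary c = 0 -> exists2 d, d \in chains L & boundary d = c.
Proof.
move=> [D DL DE] cL cycle_c; exists (linext D c); first exact: linext_chains DL cL.
have -> : boundary (linext D c) = boundary (linext D c) + linext D (boundary c).
  by rewrite cycle_c linear0 addr0.
pose F := (@boundary V \o linext D) \+ (linext D \o @boundary V).
apply: (eq_linear_chains (F := F) (G := idfun)) cL => A AL /=.
by rewrite linext_simplex linext_boundary_simplex DE // addr0.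
Qed.

Definition parity_part b : {set {set V}} := [set A in L | odd #|A| == b].

Lemma boundary_parity_part b c :
  c \in chains (parity_part b) -> boundary c \in chains (parity_part (~~ b)).
Proof.
move=> /chainsP cb; rewrite (chain_sum c) linear_sum; apply: memv_suml => A _ /=.
rewrite linearZ /= boundary_simplex; have [->|/cb] := eqVneq (c A) 0.
  by rewrite scale0r mem0v.
rewrite inE => /andP[AL /eqP <-]; apply/memvZ/memv_suml => a aA.
rewrite mem_chains_simplex inE (Lcomplex AL) ?subD1set //=.
by rewrite [in X in ~~ X](cardsD1 a) aA negbK.
Qed.

Lemma chains_parity_split c : c \in chains L -> exists c' : bool -> chain V,
  (forall b, c' b \in chains (parity_part b)) /\ c = c' true + c' false.
Proof.
move=> /chainsP cL.
exists (fun b => [ffun A : {set V} => if odd #|A| == b then c A else 0]).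
split=> [b|]; last by apply/ffunP=> A; rewrite !ffunE; case: odd; rewrite ?addr0 ?add0r.
by apply/chainsP=> A; rewrite ffunE inE; case: ifP; rewrite ?eqxx // andbT => _ /cL.
Qed.

Lemma chains_parity_disjoint b c :
  c \in chains (parity_part b) -> c \in chains (parity_part (~~ b)) -> c = 0.
Proof.
move=> /chainsP cb /chainsP cNb; apply/ffunP=> A; rewrite ffunE.
apply: contraTeq isT => nz; have := cb A nz; have := cNb A nz; rewrite !inE.
by move=> /andP[_ /eqP->] /andP[_]; case: (b).
Qed.

Lemma sum_sign_parity :
  \sum_(A in L) (-1) ^+ #|A| = #|parity_part false|%:Z - #|parity_part true|%:Z.
Proof.
rewrite (bigID (fun A : {set V} => odd #|A|)) /= addrC.
under eq_bigr => A /andP[_ /negbTE evenA] do rewrite -signr_odd evenA expr0.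
under [X in _ + X]eq_bigr => A /andP[_ oddA] do rewrite -signr_odd oddA expr1.
rewrite !sumr_const mulNrn !natz.
by congr (_%:Z - _%:Z); apply: eq_card => A; rewrite !inE ?eqbF_neg ?eqb_id.
Qed.

Hypothesis L_acyclic : forall c, c \in chains L -> boundary c = 0 ->
  exists2 d, d \in chains L & boundary d = c.

Lemma cycles_eq_boundaries b (bd := linfun (@boundary V)) :
  (chains (parity_part b) :&: lker bd = bd @: chains (parity_part (~~ b)))%VS.
Proof.
have bdE c : bd c = boundary c by rewrite lfunE.
apply/vspaceP=> c; rewrite memv_cap memv_ker bdE; apply/andP/memv_imgP; last first.
  move=> [d db ->]; rewrite !bdE boundaryK; split=> //.
  by rewrite -[b]negbK boundary_parity_part.
move=> [cb /eqP cycle_c].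
have cL : c \in chains L.
  by apply: subvP (chainsS _) _ cb; apply/subsetP=> A; rewrite inE => /andP[].
have [d /chains_parity_split[d' [d'P ->]] cE] := L_acyclic cL cycle_c.
exists (d' (~~ b)) => //; rewrite bdE.
have {cE} cE : c = boundary (d' b) + boundary (d' (~~ b)).
  by rewrite -cE linearD; case: (b); rewrite // addrC.
suff z : boundary (d' b) = 0 by rewrite cE z add0r.
apply: (chains_parity_disjoint (b := b)); last exact: boundary_parity_part.
have -> : boundary (d' b) = c - boundary (d' (~~ b)) by rewrite cE addrK.
by rewrite memvB // -[b in X in _ \in X]negbK boundary_parity_part.
Qed.

(* By rank-nullity the number of faces of either parity is the sum of the ranks of
   the two boundary maps between even and odd chains. *)
Lemma acyclic_euler : \sum_(A in L) (-1) ^+ #|A| = 0 :> int.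
Proof.
pose bd := linfun (@boundary V).
pose rank b := \dim (bd @: chains (parity_part b)).
have card_part b : #|parity_part b| = (rank (~~ b) + rank b)%N.
  rewrite -dim_chains -(limg_ker_dim bd (chains (parity_part b))).
  by rewrite cycles_eq_boundaries.
by rewrite sum_sign_parity !card_part addnC subrr.
Qed.

End EulerCharacteristic.

Section SimplicialMaps.
Variables W V : finType.
Implicit Types (phi psi : W -> V) (A B : {set W}).

Definition push phi A : chain V :=
  if #|phi @: A| == #|A| then simplex (phi @: A) else 0.

Lemma push0 phi : push phi set0 = simplex set0.
Proof. by rewrite /push imset0 !cards0. Qed.

Lemma pushU1 phi w A : w \notin A -> push phi (w |: A) = cone (phi w) (push phi A).
Proof.
move=> wA; rewrite /push imsetU1 !cardsU1 wA add1n; case: (boolP (phi w \in _)) => pw.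
  rewrite add0n ltn_eqF ?ltnS ?leq_imset_card //; case: ifP; rewrite ?linear0 // => _.
  apply/ffunP=> B; rewrite !ffunE; case: ifP => // _; case: eqP => // E.
  by rewrite E setD11 in pw.
by rewrite add1n eqSS; case: ifP; rewrite ?linear0 // cone_simplex.
Qed.

Lemma push_chain_map phi (M : {set {set W}}) : chain_map M (push phi).
Proof.
move=> A _; elim/setU1_ind: A => [|w A wA IHA].
  by rewrite push0 boundary_simplex !big_set0.
rewrite pushU1 // boundary_cone IHA big_setU1 //= setU1K // linear_sum.
congr (_ + _); apply: eq_bigr => a aA /=.
rewrite -pushU1 ?in_setD1 ?(negbTE wA) ?andbF // setDUl [[set w] :\ a](setDidPl _) //.
by rewrite disjoints1 inE; apply: contraNneq wA => ->.
Qed.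

Lemma push_powerset phi A (B : {set V}) :
  phi @: A \subset B -> push phi A \in chains (powerset B).
Proof.
move=> AB; rewrite /push; case: ifP => _; last exact: mem0v.
by rewrite mem_chains_simplex powersetE.
Qed.

Lemma contiguous_homotopic phi psi (M : {set {set W}}) (L : {set {set V}}) :
  simplicial_complex M -> simplicial_complex L ->
  (forall A, A \in M -> phi @: A :|: psi @: A \in L) ->
  homotopic M L (push phi) (push psi).
Proof.
move=> Mcomplex Lcomplex contiguous.
pose images A := phi @: A :|: psi @: A.
apply: (carrier_homotopic (phi := images) (c0 := 0) Mcomplex Lcomplex) => //.
- exact: push_chain_map.
- exact: push_chain_map.
- by move=> A B BA; rewrite setUSS ?imsetS.
- by move=> A /set0Pn[a aA]; apply/set0Pn; exists (phi a); rewrite inE imset_f.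
- by move=> A _; apply/push_powerset/subsetUl.
- by move=> A _; apply/push_powerset/subsetUr.
- exact: mem0v.
- by rewrite linear0 !push0 addrr_chain.
Qed.

End SimplicialMaps.

(* The identity of [L] is homotopic, through [s] followed by the maps [phi i] and
   then through a constant map, to zero. *)
Lemma simplicial_contraction_euler (V W : finType) (L : {set {set V}}) (M : {set {set W}})
    (s : {set V} -> chain W) (phi : nat -> W -> V) (m : nat) (v0 : V) :
  simplicial_complex L -> simplicial_complex M ->
  s set0 = simplex set0 -> chain_map L s -> (forall A, A \in L -> s A \in chains M) ->
  (forall A, A \in L -> s A \in chains [set B : {set W} | phi 0%N @: B \subset A]) ->
  (forall i (B : {set W}), (i < m)%N -> B \in M -> phi i @: B :|: phi i.+1 @: B \in L) ->
  (forall B : {set W}, B \in M -> phi m @: B \subset [set v0]) -> [set v0] \in L ->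
  \sum_(A in L) (-1) ^+ #|A| = 0 :> int.
Proof.
move=> Lcomplex Mcomplex s0 sL sM s_phi0 contiguous phi_m v0L.
have push_s i : chain_map L (fun A => linext (push (phi i)) (s A)).
  exact: (chain_map_comp sL sM (@push_chain_map _ _ (phi i) M)).
have push_s0 i : linext (push (phi i)) (s set0) = simplex set0.
  by rewrite s0 linext_simplex push0.
have id_push : homotopic L L (@simplex V) (fun A => linext (push (phi 0%N)) (s A)).
  apply: (carrier_homotopic (phi := id) (c0 := 0) Lcomplex Lcomplex) => //.
  - exact: simplex_chain_map.
  - by move=> A _; rewrite mem_chains_simplex powersetE.
  - move=> A AL; apply: linext_chains (s_phi0 A AL) => B; rewrite inE.
    exact: push_powerset.
  - exact: mem0v.
  - by rewrite linear0 push_s0 addrr_chain.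
have push_push : homotopic L L (fun A => linext (push (phi 0%N)) (s A))
    (fun A => linext (push (phi m)) (s A)).
  apply: homotopic_comp sL sM _ => //.
  elim: m contiguous {phi_m} => [_|m IHm contiguous]; first exact: homotopic_refl.
  apply: homotopic_trans (IHm _) _ => [i B /ltnW|]; first exact: contiguous.
  by apply: contiguous_homotopic => // A; apply: contiguous.
have push_const : homotopic L L (fun A => linext (push (phi m)) (s A)) (fun=> 0).
  pose point (A : {set V}) := [set v0].
  apply: (carrier_homotopic (phi := point) (c0 := simplex [set v0]) Lcomplex Lcomplex) => //.
  - by move=> A _; rewrite linear0 big1.
  - by move=> A _; apply/set0Pn; exists v0; rewrite inE.
  - by move=> A AL; apply: linext_chains (sM A AL) => B /phi_m; apply: push_powerset.
  - by move=> A _; apply: mem0v.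
  - by rewrite mem_chains_simplex powersetE.
  - by rewrite push_s0 addr0 boundary_simplex big_set1 setDv.
apply: acyclic_euler => // c; apply: homotopic_zero_cycle.
exact: homotopic_trans id_push (homotopic_trans push_push push_const).
Qed.

Section BarycentricSubdivision.
Variable W : finType.
Implicit Types (A B : {set W}) (F : {set {set W}}).

Definition flags A : {set {set {set W}}} :=
  [set F : {set {set W}} | [forall (B | B \in F), (B \subset A) && (B != set0)]
    && [forall (B | B \in F), forall (C | C \in F), (B \subset C) || (C \subset B)]].

Lemma flagsP A F :
  reflect [/\ forall B, B \in F -> B \subset A, forall B, B \in F -> B != set0
             & forall B C, B \in F -> C \in F -> (B \subset C) || (C \subset B)]
          (F \in flags A).
Proof.
rewrite inE; apply: (iffP andP) => [[/forall_inP sF /forall_inP tF]|[sF nF tF]]; split.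
- by move=> B /sF/andP[].
- by move=> B /sF/andP[].
- by move=> B C /tF/forall_inP; apply.
- by apply/forall_inP=> B BF; rewrite sF ?nF.
- by apply/forall_inP=> B BF; apply/forall_inP=> C; apply: tF.
Qed.

Lemma card_flag A F : F \in flags A -> (#|F| <= #|A|)%N.
Proof.
move=> /flagsP[sF nF tF]; pose level (B : {set W}) : 'I_#|A|.+1 := inord #|B|.
have levelE B : B \in F -> level B = #|B| :> nat.
  by move=> /sF/subset_leq_card BA; rewrite inordK.
have -> : #|F| = #|level @: F|.
  rewrite card_in_imset // => B C BF CF /(congr1 val) /=; rewrite !levelE // => BC.
  by case/orP: (tF B C BF CF) => h; [|symmetry]; apply/eqP; rewrite eqEcard h BC leqnn.
rewrite (leq_trans (subset_leq_card (_ : _ \subset [set~ ord0]))) ?cardsC1 ?card_ord //.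
apply/subsetP=> _ /imsetP[B BF ->]; rewrite !inE -val_eqE /= levelE // -lt0n card_gt0.
exact: nF.
Qed.

Lemma barycentric_subdivision : exists s : {set W} -> chain {set W},
  [/\ s set0 = simplex set0, forall A, s A \in chains (flags A)
    & forall M, chain_map M s].
Proof.
have flags0 A : set0 \in flags A.
  by apply/flagsP; split=> [B|B|B C]; rewrite inE.
have [|A _|A B _ BA|A _ A0|A _|||X [X0 Xflags XE]] :=
    acyclic_carrier (M := [set: {set W}]) (f := fun=> 0 : chain {set W})
      (carrier := flags) (c0 := simplex set0).
- by move=> A B _ _; rewrite inE.
- by rewrite linear0 big1.
- apply/subsetP=> F /flagsP[sF nF tF]; apply/flagsP; split=> // C CF.
  exact: subset_trans (sF C CF) BA.
- exists A; apply/forall_inP=> F /flagsP[sF nF tF]; apply/flagsP; split=> [B|B|B C].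
  + by rewrite !inE => /predU1P[->|/sF].
  + by rewrite !inE => /predU1P[->|/nF].
  + rewrite !inE => /predU1P[->|BF] /predU1P[->|CF]; rewrite ?subxx ?sF ?orbT //.
    exact: tF.
- exact: mem0v.
- by rewrite mem_chains_simplex.
- by rewrite boundary_simplex big_set0.
exists X; split=> [//|A|M A _]; first exact: Xflags (in_setT A).
by rewrite XE ?in_setT // add0r.
Qed.

End BarycentricSubdivision.

(** * Contractions and punctured neighbourhoods *)

Section Topology.
Variable R : realType.
Local Open Scope classical_set_scope.

Lemma within_continuous_image (S T U : topologicalType) (A : set S) (B : set T)
    (f : S -> T) (g : T -> U) :
  {within A, continuous f} -> {within B, continuous g} -> (forall x, A x -> B (f x)) ->
  {within A, continuous (fun x => g (f x))}.
Proof.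
move=> /subspace_continuousP cf /subspace_continuousP cg AB.
apply/subspace_continuousP => x Ax; apply: cvg_comp (cg _ (AB x Ax)) => N fxN.
have fN : nbhs x [set y | A y -> B (f y) -> N (f y)] by apply: cf fxN.
by apply: filterS fN => y yN Ay; apply: yN (AB y Ay).
Qed.

Lemma within_continuous_pair (S T U : topologicalType) (A : set S)
    (f : S -> T) (g : S -> U) :
  {within A, continuous f} -> {within A, continuous g} ->
  {within A, continuous (fun x => (f x, g x))}.
Proof.
move=> /subspace_continuousP cf /subspace_continuousP cg.
by apply/subspace_continuousP => x Ax; apply: (cvg_pair (cf x Ax) (cg x Ax)).
Qed.

Lemma compact_unif_continuous (S T : pseudoMetricType R) (K : set S) (f : S -> T) :
  compact K -> {within K, continuous f} -> forall e : R, 0 < e -> exists2 d : R, 0 < d &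
    forall x y, K x -> K y -> ball x d y -> ball (f x) e (f y).
Proof.
move=> /compact_near_coveringP cK /subspace_continuousP cf e e0.
pose good d x := forall y, K x -> K y -> ball x d y -> ball (f x) e (f y).
have [|d /= d0 near_d] := cK R (0 : R)^'+ good _.
  move=> x Kx; have e2_gt0 : 0 < e / 2 by rewrite divr_gt0.
  have /nbhs_ballP[d /= d0 hd] := cf x Kx _ (nbhsx_ballx (f x) _ e2_gt0).
  exists (ball x (d / 2), [set z | z < d / 2]); first split.
  - by apply/nbhs_ballP; exists (d / 2) => //=; rewrite divr_gt0.
  - by apply: nbhs_right_lt; rewrite divr_gt0.
  move=> [x' z] [/= xx' zd] y Kx' Ky x'y; apply: (@ball_splitr _ _ (f x)).
    by apply: hd => //; apply: le_ball xx'; lra.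
  by apply: hd => //; apply: (ball_split xx'); apply: le_ball x'y; apply: ltW.
have d2_gt0 : 0 < d / 2 by rewrite divr_gt0.
exists (d / 2) => // x y Kx Ky; apply: (near_d (d / 2)) => //=.
by rewrite sub0r normrN gtr0_norm; lra.
Qed.

Definition contractible_in (T : topologicalType) (A B : set T) :=
  exists (H : R * T -> T) (c : T),
  [/\ B c, {within `[0, 1] `*` A, continuous H},
      forall t x, 0 <= t <= 1 -> A x -> B (H (t, x)),
      forall x, A x -> H (0, x) = x & forall x, A x -> H (1, x) = c].

Lemma contractible_inS (T : topologicalType) (A A' B B' : set T) :
  A' `<=` A -> B `<=` B' -> contractible_in A B -> contractible_in A' B'.
Proof.
move=> AA' BB' [H [c [Bc cH HB H_at0 H_at1]]]; exists H, c; split.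
- exact: BB'.
- by apply: continuous_subspaceW cH => -[t x] [/= t01 /AA'].
- by move=> t x t01 /AA' Ax; apply/BB'/HB.
- by move=> x /AA' /H_at0.
- by move=> x /AA' /H_at1.
Qed.

Lemma contractible_in_retract (S T : topologicalType) (A' B' : set S) (A B : set T)
    (f : S -> T) (g : T -> S) :
  {within A', continuous f} -> {within B, continuous g} ->
  (forall x, A' x -> A (f x)) -> (forall y, B y -> B' (g y)) ->
  (forall x, A' x -> g (f x) = x) ->
  contractible_in A B -> contractible_in A' B'.
Proof.
move=> cf cg A'A BB' fK [H [c [Bc cH HB H_at0 H_at1]]].
exists (fun z => g (H (z.1, f z.2))), (g c); split.
- exact: BB'.
- pose id_f (z : R * S) := (z.1, f z.2).
  have c_id_f : {within `[0, 1] `*` A', continuous id_f}.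
    apply: within_continuous_pair; first by apply: continuous_subspaceT => z; exact: cvg_fst.
    apply: (within_continuous_image (f := snd) _ cf) => [|[t x] []//].
    by apply: continuous_subspaceT => z; exact: cvg_snd.
  apply: (within_continuous_image (f := H \o id_f) _ cg) => [|[t x] [/= t01 /A'A]]; last exact: HB.
  by apply: (within_continuous_image c_id_f cH) => -[t x] [/= t01 /A'A].
- by move=> t x t01 /A'A Afx; apply/BB'/HB.
- by move=> x A'x /=; rewrite H_at0 ?fK //; apply: A'A.
- by move=> x A'x /=; rewrite H_at1 //; apply: A'A.
Qed.

Section Segments.
Variable V : normedModType R.
Implicit Types (x y p c : V) (A B C : set V) (t : R) (l : {scalar V}).

Definition segment x y t : V := (1 - t) *: x + t *: y.

Lemma segment0 x y : segment x y 0 = x.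
Proof. by rewrite /segment subr0 scale1r scale0r addr0. Qed.

Lemma segment1 x y : segment x y 1 = y.
Proof. by rewrite /segment subrr scale1r scale0r add0r. Qed.

Lemma segment_form l x y t : l (segment x y t) = (1 - t) * l x + t * l y.
Proof. by rewrite linearD !linearZ. Qed.

Lemma segment_continuous (T : topologicalType) (f g : T -> V) (h : T -> R) :
  continuous f -> continuous g -> continuous h ->
  continuous (fun z => segment (f z) (g z) (h z)).
Proof.
move=> cf cg ch z; apply: cvgD; apply: cvgZ; [|exact: cf|exact: ch|exact: cg].
by apply: cvgB; [exact: cvg_cst|exact: ch].
Qed.

Lemma segment_near p (b : R) (U : set V) : nbhs p U ->
  exists k, [/\ 0 < k, k < 1 & forall y, `|p - y| <= b -> U (segment p y k)].
Proof.
move=> /nbhs_ballP[e /= e0 eU]; have b0 : 0 < `|b| + 1 by rewrite ltr_wpDl.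
pose k := Num.min (1 / 2) (e / (`|b| + 1) / 2).
have k0 : 0 < k by rewrite lt_min !divr_gt0.
have k1 : k <= 1 / 2 by rewrite ge_min lexx.
have ke : k * (`|b| + 1) <= e / 2.
  by rewrite -ler_pdivlMr // mulrAC ge_min lexx orbT.
exists k; split=> // [|y py]; first by lra.
apply: eU; rewrite -ball_normE /= (_ : p - _ = k *: (p - y)); last first.
  by rewrite /segment scalerBl scale1r scalerBr opprD opprB addrA subrKC.
rewrite normrZ gtr0_norm //; have := ler_norm b; nra.
Qed.

Definition convex C := forall x y t, C x -> C y -> 0 <= t <= 1 -> C (segment x y t).

Lemma ball_convex p (e : R) : convex (ball p e).
Proof.
move=> x y t; rewrite -!ball_normE /= => px py /andP[t0 t1].
have -> : p - segment x y t = (1 - t) *: (p - x) + t *: (p - y).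
  by rewrite /segment !scalerBr addrACA -scalerDl subrK scale1r opprD.
apply: le_lt_trans (ler_normD _ _) _.
rewrite !normrZ !ger0_norm ?subr_ge0 //.
apply: (@le_lt_trans _ _ (Num.max `|p - x| `|p - y|)); last by rewrite gt_max px.
set m := Num.max _ _.
have [xm ym] : `|p - x| <= m /\ `|p - y| <= m by rewrite !le_max !lexx orbT.
nra.
Qed.

Lemma segment_contractible_in A B c : B c ->
  (forall x t, A x -> 0 <= t <= 1 -> B (segment x c t)) -> contractible_in A B.
Proof.
move=> Bc AB; exists (fun z => segment z.2 c z.1), c; split=> //.
- apply/continuous_subspaceT/segment_continuous => z; first exact: cvg_snd.
    exact: cvg_cst.
  exact: cvg_fst.
- by move=> t x t01 Ax; apply: AB.
- by move=> x _; apply: segment0.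
- by move=> x _; apply: segment1.
Qed.

Lemma convex_contractible C c : convex C -> C c -> contractible_in C C.
Proof.
by move=> convC Cc; apply: (segment_contractible_in Cc) => x t Cx; apply: convC.
Qed.

End Segments.

(* For convex [A] this says that [p] is on the relative boundary; interior points of a
   manifold of positive dimension do not have the property. *)
Definition null_puncture (T : topologicalType) (A : set T) p := forall U, nbhs p U ->
  exists2 W, nbhs p W & contractible_in ((A `&` W) `\ p) ((A `&` U) `\ p).

Lemma null_puncture_local (T : topologicalType) (A B N : set T) p :
  nbhs p N -> (forall x, N x -> A x <-> B x) -> null_puncture A p -> null_puncture B p.
Proof.
move=> pN AB nullA U pU; have [W pW AWU] := nullA (U `&` N) (filterI pU pN).
exists (W `&` N); first exact: filterI.
by apply: contractible_inS AWU => x [[xA [xU xN]] xp]; split=> //; split=> //; apply/AB.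
Qed.

Lemma null_puncture_interior (T : topologicalType) (A : set T) p :
  nbhs p A -> null_puncture A p <-> null_puncture [set: T] p.
Proof. by move=> pA; split; apply: (null_puncture_local pA). Qed.

Definition homeo_on (S T : topologicalType) (A : set S) (B : set T)
    (f : S -> T) (g : T -> S) :=
  [/\ {within A, continuous f}, {within B, continuous g},
      forall x, A x -> B (f x), forall y, B y -> A (g y)
    & (forall x, A x -> g (f x) = x) /\ (forall y, B y -> f (g y) = y)].

Lemma homeo_on_sym (S T : topologicalType) (A : set S) (B : set T) f g :
  homeo_on A B f g -> homeo_on B A g f.
Proof. by case=> cf cg AB BA [fK gK]. Qed.

Lemma homeo_on_contractible (S T : topologicalType) (A : set S) (B : set T) f g :
  homeo_on A B f g -> contractible_in B B -> contractible_in A A.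
Proof. by case=> cf cg AB BA [fK _]; apply: contractible_in_retract cf cg AB BA fK. Qed.

Lemma homeo_on_null_puncture (S T : topologicalType) (A : set S) (B : set T) f g p :
  homeo_on A B f g -> A p -> null_puncture B (f p) -> null_puncture A p.
Proof.
move=> [cf cg AB BA [fK gK]] Ap nullB U pU.
move: cf cg => /[dup] cf /subspace_continuousP/(_ p Ap) cont_f.
move=> /[dup] cg /subspace_continuousP/(_ (f p) (AB p Ap)).
rewrite /from_subspace fK // => /(_ U pU) cont_g; have [W pW BWU] := nullB _ cont_g.
exists [set x | A x -> W (f x)]; first exact: cont_f.
apply: contractible_in_retract BWU.
- by apply: continuous_subspaceW cf => x [[]].
- by apply: continuous_subspaceW cg => y [[]].
- move=> x [[Ax Wfx] xp]; split; first by split; [apply: AB|apply: Wfx].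
  by move=> /= fxp; apply: xp; rewrite /= -(fK x) // fxp fK.
- move=> y [[By Ugy] yp]; split; first by split; [apply: BA|apply: Ugy].
  by move=> /= gyp; apply: yp; rewrite /= -(gK y) // gyp.
- by move=> x [[Ax _] _]; apply: fK.
Qed.

Lemma translation_null_puncture (V : normedModType R) (p q : V) :
  null_puncture [set: V] q -> null_puncture [set: V] p.
Proof.
have shift_cont (a : V) : {within [set: V], continuous (fun x => x + a)}.
  by apply: continuous_subspaceT => x; apply: cvgD; [exact: cvg_id|exact: cvg_cst].
have : homeo_on [set: V] [set: V] (fun x => x + (q - p)) (fun x => x + (p - q)).
  by split=> //; split=> x _; rewrite -addrA -[p - q]opprB ?subrr ?addNr addr0.
move/homeo_on_null_puncture => /(_ p I); rewrite addrC subrK; exact.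
Qed.

(* Near [p] the punctured convex set is star-shaped with respect to any of its points
   with a larger value of [l], since segments to that point cannot pass through [p]. *)
Lemma convex_null_puncture (V : normedModType R) (C : set V) (l : {scalar V}) p c :
  convex C -> C p -> C c -> l p < l c -> (forall x, C x -> l p <= l x) ->
  null_puncture C p.
Proof.
move=> convC Cp Cc lpc lp_min U /nbhs_ballP[e /= e0 eU].
have pe : nbhs p (ball p e) by apply: nbhsx_ballx.
have [k [k0 k1 /(_ c (lexx _)) pck]] := segment_near `|p - c| pe.
set c' := segment p c k in pck.
have Cc' : C c' by apply: convC; rewrite ?ltW.
have lpc' : l p < l c' by rewrite segment_form; nra.
exists (ball p e) => //; apply: (@segment_contractible_in _ _ _ c').
  split; first by split=> //; apply: eU.
  by move=> /= c'p; rewrite c'p ltxx in lpc'.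
move=> x t [[Cx px] xp] t01; split; first split.
- exact: convC.
- exact/eU/ball_convex.
have lpx := lp_min x Cx; have /andP[t0 t1] := t01; move: t0.
rewrite le_eqVlt => /predU1P[<-|t0]; first by rewrite segment0.
move=> /= xc'p; have := segment_form l x c' t; rewrite xc'p; nra.
Qed.

End Topology.

(** * Geometric realizations *)

Section Realization.
Variables (R : realType) (V : finType).
Implicit Types (p q x y : 'rV[R]_#|V|) (u v : V) (A B : {set V}) (L : {set {set V}}).

Definition bary v p : R := p ord0 (enum_rank v).

Lemma bary_is_linear v : scalar (bary v).
Proof. by move=> a x y; rewrite /bary !mxE. Qed.
HB.instance Definition _ v :=
  GRing.isLinear.Build R 'rV[R]_#|V| R *%R (bary v) (bary_is_linear v).

Lemma bary_inj p q : (forall v, bary v p = bary v q) -> p = q.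
Proof. by move=> pq; apply/rowP => i; rewrite -(enum_valK i); apply: pq. Qed.

Lemma bary_continuous v : continuous (bary v).
Proof. exact: coord_continuous. Qed.

Lemma ler_bary_norm v p : `|bary v p| <= `|p|.
Proof. by rewrite [leRHS]mx_normrE; apply: (le_bigmax _ _ (ord0, enum_rank v)). Qed.

Definition supp p : {set V} := [set v | bary v p != 0].

Lemma in_supp p v : (v \in supp p) = (bary v p != 0).
Proof. by rewrite inE. Qed.

Lemma notin_supp p v : v \notin supp p -> bary v p = 0.
Proof. by rewrite in_supp negbK => /eqP. Qed.

Lemma supp_near p : \forall q \near p, supp p \subset supp q.
Proof.
have near_v v : \forall q \near p, v \in supp p -> v \in supp q.
  have [vp|_] := boolP (v \in supp p); last by apply: (@nearW _ (nbhs p)).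
  rewrite in_supp in vp; have : \forall q \near p, bary v q != 0.
    exact: (cvgr_neq0 (V := R^o)) (@bary_continuous v p) vp.
  by apply: (@filterS _ (nbhs p)) => q qv _; rewrite in_supp.
have := filter_forall (nbhs_filter p) near_v; apply: (@filterS _ (nbhs p)) => q pq.
by apply/subsetP=> v; apply: pq.
Qed.

Lemma realizationP L p : realization (R := R) L p <->
  [/\ forall v, 0 <= bary v p, \sum_v bary v p = 1 & supp p \in L].
Proof.
have sumE : \sum_i p ord0 i = \sum_v bary v p.
  by rewrite (reindex (@enum_rank V)) //; apply/onW_bij/enum_rank_bij.
split=> -[p_ge0 p_sum1 pL]; split=> //.
- by move=> v; apply: p_ge0.
- by rewrite -sumE.
- by move=> i; rewrite -(enum_valK i); apply: p_ge0.
- by rewrite sumE.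
Qed.

Lemma realizationS L L' p : L \subset L' -> realization L p -> realization L' p.
Proof.
by move=> /subsetP LL' /realizationP[p_ge0 p_sum1 /LL' pL']; apply/realizationP.
Qed.

Lemma bary_le1 L v p : realization L p -> bary v p <= 1.
Proof. by move=> /realizationP[p_ge0 <- _]; rewrite (bigD1 v) //= lerDl sumr_ge0. Qed.

Lemma realization_norm_le1 L p : realization L p -> `|p| <= 1.
Proof.
move=> Lp; rewrite [leLHS]mx_normrE; apply/bigmax_leP; split=> // -[i j] _ /=.
rewrite ord1 -(enum_valK j) ger0_norm; first exact: bary_le1 Lp.
by have /realizationP[p_ge0 _ _] := Lp; apply: p_ge0.
Qed.

Lemma supp_neq0 L p : realization L p -> supp p != set0.
Proof.
move=> /realizationP[_ p_sum1 _]; apply: contra_eq_neq p_sum1 => supp0.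
rewrite big1 => [|v _]; first by rewrite eq_sym oner_eq0.
by apply: notin_supp; rewrite supp0 inE.
Qed.

Lemma bary_segment v x y t :
  bary v (segment x y t) = (1 - t) * bary v x + t * bary v y.
Proof. exact: segment_form. Qed.

Lemma supp_segment_sub x y t : supp (segment x y t) \subset supp x :|: supp y.
Proof.
apply/subsetP=> v; apply: contraTT.
rewrite in_setU negb_or => /andP[/notin_supp xv /notin_supp yv].
by rewrite in_supp negbK bary_segment xv yv !mulr0 addr0.
Qed.

Lemma supp_segment L L' x y t : realization L x -> realization L' y -> 0 < t -> t < 1 ->
  supp (segment x y t) = supp x :|: supp y.
Proof.
move=> /realizationP[x_ge0 _ _] /realizationP[y_ge0 _ _] t0 t1.
apply/eqP; rewrite eqEsubset supp_segment_sub; apply/subsetP=> v.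
have t1' : 0 < 1 - t by rewrite subr_gt0.
rewrite in_setU !in_supp bary_segment paddr_eq0; first last.
- by rewrite mulr_ge0 // ltW.
- by rewrite mulr_ge0 // ltW.
by rewrite !mulf_eq0 (gt_eqF t0) (gt_eqF t1') negb_and.
Qed.

Lemma realization_segment L x y t : simplicial_complex L ->
  realization L x -> realization L y -> supp x :|: supp y \in L -> 0 <= t <= 1 ->
  realization L (segment x y t).
Proof.
move=> Lcomplex /realizationP[x_ge0 x_sum1 _] /realizationP[y_ge0 y_sum1 _] xyL.
move=> /andP[t0 t1].
apply/realizationP; split=> [v||].
- by rewrite bary_segment addr_ge0 // mulr_ge0 // subr_ge0.
- under eq_bigr => v _ do rewrite bary_segment.
  by rewrite big_split /= -!mulr_sumr x_sum1 y_sum1 !mulr1 subrK.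
- exact: Lcomplex xyL (supp_segment_sub _ _ _).
Qed.

Lemma powerset_complex A : simplicial_complex (powerset A).
Proof. by move=> B C; rewrite !powersetE => BA /subset_trans; apply. Qed.

Lemma realization_powerset_convex A : convex (realization (R := R) (powerset A)).
Proof.
move=> x y t Ax Ay; apply: realization_segment => //; first exact: powerset_complex.
have /realizationP[_ _] := Ax; have /realizationP[_ _] := Ay.
by rewrite !powersetE subUset => -> ->.
Qed.

End Realization.

Section Centroid.
Variables (R : realType) (W : finType).
Implicit Types B C : {set W}.

Definition centroid (U : lmodType R) B (x : W -> U) : U :=
  #|B|%:R^-1 *: \sum_(w in B) x w.

Lemma card_set_neq0 B : B != set0 -> #|B|%:R != 0 :> R.
Proof. by rewrite pnatr_eq0 cards_eq0. Qed.

Lemma ler_dist_centroid (U : normedModType R) B C (x : W -> U) (d : R) :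
  B != set0 -> B \subset C ->
  (forall w w', w \in C -> w' \in C -> `|x w - x w'| <= d) ->
  `|centroid B x - centroid C x| <= (1 - #|C|%:R^-1) * d.
Proof.
move=> B0 BC xd; have C0 : C != set0 by apply: contraNneq B0 => C0; rewrite -subset0 -C0.
have [b0 c0] : 0 < #|B|%:R :> R /\ 0 < #|C|%:R :> R by rewrite !ltr0n !card_gt0.
have -> : centroid B x - centroid C x =
    (#|B|%:R * #|C|%:R)^-1 *: \sum_(w in B) \sum_(w' in C) (x w - x w').
  under eq_bigr => w _ do rewrite sumrB sumr_const -scaler_nat.
  rewrite sumrB sumr_const -[X in _ *: (_ - X)]scaler_nat -scaler_sumr scalerBr !scalerA.
  rewrite /centroid.
  by congr (_ *: _ - _ *: _); field; rewrite ?card_set_neq0.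
rewrite normrZ gtr0_norm ?invr_gt0 ?mulr_gt0 // ler_pdivrMl ?mulr_gt0 //.
have -> : #|B|%:R * #|C|%:R * ((1 - #|C|%:R^-1) * d) = \sum_(w in B) ((#|C|%:R - 1) * d).
  by rewrite sumr_const -mulr_natl; field; rewrite card_set_neq0.
apply: le_trans (ler_norm_sum _ _ _) _; apply: ler_sum => w wB.
have wC := subsetP BC w wB; apply: le_trans (ler_norm_sum _ _ _) _.
rewrite (big_setD1 w) //= subrr normr0 add0r.
have -> : #|C|%:R - 1 = #|C :\ w|%:R :> R by rewrite (cardsD1 w C) wC natrD addrC addKr.
rewrite mulr_natl -sumr_const; apply: ler_sum => w' /setD1P[_ w'C]; exact: xd.
Qed.

End Centroid.

Section Barycenters.
Variables (R : realType) (V : finType).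
Implicit Types (A s : {set V}) (D : {set {set V}}).

Lemma bary_centroid (W : finType) (B : {set W}) (x : W -> 'rV[R]_#|V|) v :
  bary v (centroid B x) = (\sum_(w in B) bary v (x w)) / #|B|%:R.
Proof. by rewrite linearZ linear_sum mulrC. Qed.

Lemma realization_centroid (W : finType) (B : {set W}) (x : W -> 'rV[R]_#|V|) A :
  B != set0 -> (forall w, w \in B -> realization (powerset A) (x w)) ->
  realization (powerset A) (centroid B x).
Proof.
move=> B0 xA.
have {xA} x_spec w : w \in B -> [/\ forall v, 0 <= bary v (x w), \sum_v bary v (x w) = 1
    & supp (x w) \subset A] by move=> /xA/realizationP; rewrite powersetE.
apply/realizationP; split=> [v||].
- rewrite bary_centroid divr_ge0 // sumr_ge0 // => w /x_spec[x_ge0 _ _]; exact: x_ge0.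
- under eq_bigr => v _ do rewrite bary_centroid.
  rewrite -mulr_suml exchange_big /=.
  under eq_bigr => w /x_spec[_ -> _] do [].
  by rewrite sumr_const divff ?card_set_neq0.
rewrite powersetE; apply/subsetP=> v; apply: contraTT => vA.
rewrite in_supp negbK bary_centroid big1 ?mul0r // => w /x_spec[_ _ /subsetP xA].
by apply: notin_supp; apply: contra vA => /xA.
Qed.

Definition corner (v : V) : 'rV[R]_#|V| := delta_mx 0 (enum_rank v).

Lemma bary_corner u v : bary u (corner v) = (u == v)%:R.
Proof. by rewrite /bary mxE eqxx (inj_eq enum_rank_inj). Qed.

Lemma realization_corner v A : v \in A -> realization (powerset A) (corner v).
Proof.
move=> vA; apply/realizationP; split=> [u||]; first by rewrite bary_corner ler0n.
  rewrite (bigD1 v) //= bary_corner eqxx big1 ?addr0 // => u uv.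
  by rewrite bary_corner (negbTE uv).
rewrite powersetE; apply/subsetP=> u; rewrite in_supp bary_corner pnatr_eq0 eqb0 negbK.
by move/eqP=> ->.
Qed.

Definition barycenter s := centroid s corner.

Lemma bary_barycenter s v : bary v (barycenter s) = (v \in s)%:R / #|s|%:R.
Proof.
rewrite bary_centroid; congr (_ / _).
case: (boolP (v \in s)) => vs.
  rewrite (bigD1 v) //= bary_corner eqxx big1 ?addr0 // => u /andP[_ uv].
  by rewrite bary_corner eq_sym (negbTE uv).
by rewrite big1 // => u us; rewrite bary_corner; case: eqP => // vu; rewrite vu us in vs.
Qed.

Lemma supp_barycenter s : s != set0 -> supp (barycenter s) = s.
Proof.
move=> s0; apply/setP=> v; rewrite in_supp bary_barycenter mulf_eq0 invr_eq0.
by rewrite (negbTE (card_set_neq0 R s0)) orbF pnatr_eq0 eqb0 negbK.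
Qed.

Lemma realization_barycenter D s : s != set0 -> s \in D -> realization D (barycenter s).
Proof.
move=> s0 sD; apply/realizationP; rewrite supp_barycenter //.
suff /realizationP[] : realization (powerset s) (barycenter s) by [].
by apply: realization_centroid => // v; apply: realization_corner.
Qed.

End Barycenters.

Section FineSubdivisions.
Variables (R : realType) (V : finType).
Implicit Types (A : {set V}) (e : R).

Definition small_cells (W : finType) (pos : W -> 'rV[R]_#|V|) A e : {set {set W}} :=
  [set B : {set W} | (#|B| <= #|A|)%N &&
     `[< (forall w, w \in B -> realization (powerset A) (pos w)) /\
         (forall w w', w \in B -> w' \in B -> `|pos w - pos w'| <= e) >]].

Lemma small_cellsP W pos A e (B : {set W}) :
  reflect [/\ (#|B| <= #|A|)%N, forall w, w \in B -> realization (powerset A) (pos w)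
             & forall w w', w \in B -> w' \in B -> `|pos w - pos w'| <= e]
          (B \in small_cells pos A e).
Proof.
rewrite inE; apply: (iffP andP) => [[cB /asboolP[]]|[cB Bpos Be]] //.
by split=> //; apply/asboolP.
Qed.

Definition has_subdivision e :=
  exists (W : finType) (pos : W -> 'rV[R]_#|V|) (s : {set V} -> chain W),
  [/\ s set0 = simplex set0, forall M, chain_map M s
    & forall A, s A \in chains (small_cells pos A e)].

Lemma trivial_subdivision : has_subdivision 2.
Proof.
exists V, (@corner R V), (@simplex V); split=> // [M|A]; first exact: simplex_chain_map.
rewrite mem_chains_simplex; apply/small_cellsP; split=> // [w|v w vA wA].
  exact: realization_corner.
have corner_le1 u : u \in A -> `|corner R u| <= 1.
  by move/(realization_corner R)/realization_norm_le1.
by apply: le_trans (ler_normB _ _) _; apply: lerD; apply: corner_le1.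
Qed.

(* The centroids of two nested faces of a cell of [n] vertices and diameter [e]
   are at distance at most [(1 - n^-1) * e]. *)
Lemma refine_subdivision e :
  has_subdivision e -> has_subdivision ((1 - #|V|%:R^-1) * e).
Proof.
move=> [W [pos [s [s0 s_chain s_cells]]]].
have [sd [sd0 sd_flags sd_chain]] := barycentric_subdivision W.
exists {set W}, (fun B => centroid B pos), (fun A => linext sd (s A)); split=> [|M|A].
- by rewrite s0 linext_simplex.
- apply: (chain_map_comp (M := [set: {set W}]) (s_chain M)) => // A _.
  by apply/chainsP=> B; rewrite inE.
apply: linext_chains (s_cells A) => B /small_cellsP[cB Bpos Be].
apply: subvP (chainsS _) _ (sd_flags B); apply/subsetP=> F F_flag.
have /flagsP[FB F0 F_chain] := F_flag; apply/small_cellsP; split.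
- exact: leq_trans (card_flag F_flag) cB.
- move=> C CF; apply: realization_centroid => [|w /(subsetP (FB C CF))]; first exact: F0.
  exact: Bpos.
have nested C C' : C \in F -> C' \in F -> C \subset C' ->
    `|centroid C pos - centroid C' pos| <= (1 - #|V|%:R^-1) * e.
  move=> CF C'F CC'; have C'B := subsetP (FB C' C'F).
  apply: le_trans (ler_dist_centroid (F0 C CF) CC' (d := e) _) _.
    by move=> w w' /C'B wB /C'B; apply: Be.
  have [w wC'] := set0Pn _ (F0 C' C'F).
  have e0 : 0 <= e by apply: le_trans (Be w w (C'B w wC') (C'B w wC')).
  have C'V : (#|C'| <= #|V|)%N.
    exact: leq_trans (subset_leq_card (FB C' C'F)) (leq_trans cB (max_card _)).
  have C'0 : (0 < #|C'|)%N by rewrite card_gt0 F0.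
  apply: ler_wpM2r => //; rewrite lerD2l lerN2 lef_pV2 ?posrE ?ltr0n ?ler_nat //.
  exact: leq_trans C'V.
move=> C C' CF C'F.
by case/orP: (F_chain C C' CF C'F) => ?; [|rewrite distrC]; apply: nested.
Qed.

Lemma fine_subdivision e : (0 < #|V|)%N -> 0 < e -> has_subdivision e.
Proof.
move=> V0 e0; set q : R := 1 - #|V|%:R^-1.
have [q0 q1] : 0 <= q /\ q < 1.
  by rewrite subr_ge0 invf_le1 ?ltr0n // ler1n V0 ltrBlDr ltrDl invr_gt0 ltr0n.
have sub_n n : has_subdivision (q ^+ n * 2).
  elim: n => [|n IHn]; first by rewrite expr0 mul1r; apply: trivial_subdivision.
  by rewrite exprS -mulrA; apply: refine_subdivision.
have e2_gt0 : 0 < e / 2 by rewrite divr_gt0.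
have := @cvg_expr R q; rewrite ger0_norm // => /(_ q1)/cvgrPdist_le/(_ _ e2_gt0).
move=> [n _ /(_ n (leqnn n))].
rewrite sub0r normrN normrX ger0_norm // ler_pdivlMr // => qne.
have [W [pos [s [s0 s_chain s_cells]]]] := sub_n n; exists W, pos, s; split=> // A.
apply: subvP (chainsS _) _ (s_cells A); apply/subsetP=> B /small_cellsP[cB Bpos Be].
by apply/small_cellsP; split=> // w w' wB w'B; apply: le_trans (Be w w' wB w'B) qne.
Qed.

End FineSubdivisions.

(** * Contractible complexes and links *)

Section ContractibleComplex.
Variables (R : realType) (V : finType) (L : {set {set V}}).
Hypothesis Lcomplex : simplicial_complex L.
Implicit Types p q x : 'rV[R]_#|V|.
Let geom : set 'rV[R]_#|V| := realization L.

Lemma realization_compact : compact geom.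
Proof.
apply: bounded_closed_compact.
  exists 1; split; first exact: num_real.
  by move=> b b1 p /realization_norm_le1 p_le1; apply: le_trans p_le1 (ltW b1).
have -> : geom = ((\bigcap_(v in [set: V]) (bary v @^-1` [set a | 0 <= a]))
    `&` ((fun p => \sum_v bary v p) @^-1` [set a | a = 1])
    `&` [set p | supp p \in L])%classic.
  apply/seteqP; split=> p; last first.
    by move=> [[p_ge0 p_sum1] pL]; apply/realizationP; split=> // v; apply: p_ge0.
  by move=> /realizationP[p_ge0 p_sum1 pL]; split=> //; split=> // v _; apply: p_ge0.
apply: closedI; first apply: closedI.
- apply: closed_bigI => v _; apply: preimage_closed => [p _|]; last exact: closed_ge.
  exact: bary_continuous.
- apply: preimage_closed => [p _|]; last exact: closed_eq.
  apply: (@continuous_big R^o) => [|v _]; first exact: add_continuous.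
  exact: bary_continuous.
move=> p closure_p; have [q [qL pq]] := closure_p _ (supp_near p).
exact: Lcomplex qL pq.
Qed.

Lemma card_vertices_gt0 p : geom p -> (0 < #|V|)%N.
Proof. by move=> /supp_neq0/set0Pn[v _]; apply/card_gt0P; exists v. Qed.

Section Label.
Variable v0 : V.

Definition label p : V := [arg max_(v > v0) bary v p]%O.

Lemma label_ge p : geom p -> #|V|%:R^-1 <= bary (label p) p.
Proof.
move=> Lp; have V0 := card_vertices_gt0 Lp; have /realizationP[_ p_sum1 _] := Lp.
rewrite /label; case: Order.TotalTheory.arg_maxP => // v _ v_max.
rewrite -[_^-1]mulr1 ler_pdivrMl ?ltr0n // mulr_natl -sumr_const -[leLHS]p_sum1.
by apply: ler_sum => u _; apply: v_max.
Qed.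

Lemma label_near_supp p q : geom q -> `|p - q| < #|V|%:R^-1 -> label q \in supp p.
Proof.
move=> Lq pq; rewrite in_supp; apply: contraTneq pq => pv0; rewrite -leNgt.
apply: le_trans (label_ge Lq) _; apply: le_trans (ler_bary_norm (label q) _).
by rewrite linearB /= pv0 sub0r normrN ler_norm.
Qed.

Lemma label_supp p : geom p -> label p \in supp p.
Proof.
move=> Lp; apply: label_near_supp => //.
by rewrite subrr normr0 invr_gt0 ltr0n (card_vertices_gt0 Lp).
Qed.

Lemma labels_contiguous (W : finType) (pos : W -> 'rV[R]_#|V|)
    (H : R * 'rV[R]_#|V| -> 'rV[R]_#|V|) (d t t' : R) (B : {set W}) :
  set0 \in L -> (forall t x, 0 <= t <= 1 -> geom x -> geom (H (t, x))) ->
  (forall z z' : R * 'rV[R]_#|V|,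
     (`[0, 1] `*` geom)%classic z -> (`[0, 1] `*` geom)%classic z' ->
     ball z d z' -> ball (H z) #|V|%:R^-1 (H z')) ->
  0 <= t <= 1 -> 0 <= t' <= 1 -> `|t - t'| < d -> (forall w, w \in B -> geom (pos w)) ->
  (forall w w', w \in B -> w' \in B -> `|pos w - pos w'| < d) ->
  (fun w => label (H (t, pos w))) @: B :|: (fun w => label (H (t', pos w))) @: B \in L.
Proof.
move=> L0 HL H_unif t01 t'01 tt' LB dB.
have [->|/set0Pn[w0 w0B]] := eqVneq B set0; first by rewrite !imset0 setU0.
have /realizationP[_ _ H_L] := HL _ _ t01 (LB w0 w0B); apply: Lcomplex H_L _.
have near w r : w \in B -> 0 <= r <= 1 -> `|t - r| < d ->
    label (H (r, pos w)) \in supp (H (t, pos w0)).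
  move=> wB r01 tr; apply: label_near_supp; first exact: HL r01 (LB w wB).
  have : ball (H (t, pos w0)) #|V|%:R^-1 (H (r, pos w)).
    apply: H_unif; [by split; last exact: LB|by split; last exact: LB|].
    by split; rewrite -ball_normE /=; [|apply: dB].
  by rewrite -ball_normE.
apply/subsetP=> v /setUP[] /imsetP[w wB ->]; apply: near => //.
by rewrite subrr normr0; apply: le_lt_trans tt'.
Qed.

End Label.

Lemma contractible_euler : contractible_in R geom geom ->
  \sum_(A in L) (-1) ^+ #|A| = 0 :> int.
Proof.
move=> [H [c [Lc cH HL H_at0 H_at1]]].
have V0 := card_vertices_gt0 Lc; have N0 : 0 < #|V|%:R^-1 :> R by rewrite invr_gt0 ltr0n.
have [v0 _] := set0Pn _ (supp_neq0 Lc).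
have [d d0 H_unif] := compact_unif_continuous
  (compact_setX (@segment_compact R 0 1) realization_compact) cH N0.
have d2_gt0 : 0 < d / 2 by rewrite divr_gt0.
have [W [pos [s [s0 s_chain s_cells]]]] := fine_subdivision V0 d2_gt0.
have [n md] := ltr_add_invr d0; pose m := n.+1; rewrite add0r -/m in md.
pose time i : R := i%:R / m%:R.
have time01 i : (i <= m)%N -> 0 <= time i <= 1.
  by move=> im; rewrite /time divr_ge0 //= ler_pdivrMr ?ltr0n // mul1r ler_nat.
pose phi i w := label v0 (H (time i, pos w)).
pose M := [set B : {set W} | `[< (forall w, w \in B -> geom (pos w)) /\
  (forall w w', w \in B -> w' \in B -> `|pos w - pos w'| < d) >]].
have cells_geom A w : A \in L -> realization (powerset A) (pos w) -> geom (pos w).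
  move=> AL; apply: realizationS; apply/subsetP=> B; rewrite powersetE.
  exact: Lcomplex.
apply: (simplicial_contraction_euler (M := M) (s := s) (phi := phi) (m := m)
  (v0 := label v0 c)) => //.
- move=> B C; rewrite !inE => /asboolP[LB dB] /subsetP CB; apply/asboolP.
  by split=> [w /CB|w w' /CB wB /CB]; [apply: LB|apply: dB].
- move=> A AL; apply: subvP (chainsS _) _ (s_cells A).
  apply/subsetP=> B /small_cellsP[_ Bpos dB]; rewrite inE; apply/asboolP.
  split=> [w /Bpos|w w' wB w'B]; first exact: cells_geom.
  by apply: le_lt_trans (dB w w' wB w'B) _; lra.
- move=> A AL; apply: subvP (chainsS _) _ (s_cells A).
  apply/subsetP=> B /small_cellsP[_ Bpos _]; rewrite inE.
  apply/subsetP=> _ /imsetP[w wB ->].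
  have Lw := cells_geom A w AL (Bpos w wB); rewrite /phi /time mul0r H_at0 //.
  have /realizationP[_ _] := Bpos w wB; rewrite powersetE => /subsetP; apply.
  exact: label_supp.
- move=> i B im; rewrite inE => /asboolP[LB dB].
  apply: labels_contiguous HL H_unif (time01 i (ltnW im)) (time01 i.+1 im) _ LB dB.
    by have /realizationP[_ _ cL] := Lc; apply: Lcomplex cL (sub0set _).
  by rewrite /time -mulrBl -natr1 opprD addNKr mulN1r normrN gtr0_norm ?invr_gt0.
- move=> B; rewrite inE => /asboolP[LB _]; apply/subsetP=> _ /imsetP[w wB ->].
  by rewrite inE /phi /time divff ?pnatr_eq0 // H_at1 //; apply: LB.
- have /realizationP[_ _ cL] := Lc; apply: Lcomplex cL _.
  by rewrite sub1set label_supp.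
Qed.

End ContractibleComplex.

Section RadialProjection.
Variables (R : realType) (V : finType) (D : {set {set V}}).
Hypothesis Dcomplex : simplicial_complex D.
Variable p : 'rV[R]_#|V|.
Hypothesis Dp : realization D p.
Implicit Types x y : 'rV[R]_#|V|.
Let geom : set 'rV[R]_#|V| := realization D.

(* The boundary of [s] joined with its link: the sphere of directions at an
   interior point of the face [s]. *)
Definition point_link (s : {set V}) : {set {set V}} :=
  [set G : {set V} | (G :|: s \in D) && ~~ (s \subset G)].

Lemma point_link_complex s : simplicial_complex (point_link s).
Proof.
move=> A B; rewrite !inE => /andP[AD sA] BA.
rewrite (Dcomplex AD (setSU s BA)) /=.
by apply: contra sA => /subset_trans; apply.
Qed.

Definition min_ratio y : R := \big[Num.min/1]_(v in supp p) (bary v y / bary v p).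

(* The point where the ray from [p] through [y] leaves the star of [supp p]. *)
Definition radial_projection y := (1 - min_ratio y)^-1 *: (y - min_ratio y *: p).

Lemma bary_center_gt0 v : v \in supp p -> 0 < bary v p.
Proof. by have /realizationP[p_ge0 _ _] := Dp; rewrite in_supp lt_def p_ge0 andbT. Qed.

Lemma bary_radial_projection v y :
  bary v (radial_projection y) = (bary v y - min_ratio y * bary v p) / (1 - min_ratio y).
Proof. by rewrite linearZ linearB linearZ mulrC. Qed.

Lemma min_ratio_le v y : v \in supp p -> min_ratio y * bary v p <= bary v y.
Proof. by move=> vp; rewrite -ler_pdivlMr ?bary_center_gt0 //; apply: bigmin_le_cond. Qed.

Lemma min_ratio_lt1 y : geom y -> y <> p -> min_ratio y < 1.
Proof.
move=> Dy yp; have /realizationP[y_ge0 y_sum1 _] := Dy; have /realizationP[_ p_sum1 _] := Dp.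
rewrite ltNge; apply/negP => min_ratio_ge1; apply: yp.
have le_py v : 0 <= bary v y - bary v p.
  rewrite subr_ge0; have [vp|/notin_supp ->] := boolP (v \in supp p); last exact: y_ge0.
  apply: le_trans (min_ratio_le y vp); apply: ler_peMl min_ratio_ge1.
  exact/ltW/bary_center_gt0.
have sum0 : \sum_v (bary v y - bary v p) = 0 by rewrite sumrB y_sum1 p_sum1 subrr.
apply: bary_inj => v; apply/eqP; rewrite -subr_eq0; apply/eqP.
exact: (psumr_eq0P (fun u _ => le_py u) sum0).
Qed.

Lemma min_ratio_attained y : min_ratio y < 1 ->
  exists2 v, v \in supp p & bary v y = min_ratio y * bary v p.
Proof.
move=> lt1; set goal := exists2 v, _ & _; have [//|no_v] := pselect goal.
suff : min_ratio y < min_ratio y by rewrite ltxx.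
rewrite {2}/min_ratio; apply/bigmin_gtP; split=> // v vp.
rewrite ltr_pdivlMr ?bary_center_gt0 // lt_neqAle min_ratio_le // andbT.
by apply/eqP => vE; apply: no_v; exists v.
Qed.

Lemma radial_projection_link y : geom y -> y <> p -> supp p \subset supp y ->
  realization (point_link (supp p)) (radial_projection y).
Proof.
move=> Dy yp py; have /realizationP[y_ge0 y_sum1 yD] := Dy; have /realizationP[_ p_sum1 _] := Dp.
have lt1 := min_ratio_lt1 Dy yp; have gap : 0 < 1 - min_ratio y by rewrite subr_gt0.
apply/realizationP; split=> [v||].
- rewrite bary_radial_projection; apply: divr_ge0 (ltW gap); rewrite subr_ge0.
  by have [/min_ratio_le//|/notin_supp ->] := boolP (v \in supp p); rewrite mulr0.
- under eq_bigr => v _ do rewrite bary_radial_projection.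
  by rewrite -mulr_suml sumrB -mulr_sumr y_sum1 p_sum1 mulr1 divff ?gt_eqF.
rewrite inE; apply/andP; split.
  apply: Dcomplex yD _; rewrite subUset py andbT; apply/subsetP=> v.
  apply: contraTT => vy; have vp : v \notin supp p by apply: contra vy => /(subsetP py).
  rewrite in_supp negbK bary_radial_projection.
  by rewrite (notin_supp vy) (notin_supp vp) mulr0 subrr mul0r.
have [v vp yv] := min_ratio_attained lt1; apply/subsetPn; exists v => //.
by rewrite in_supp negbK bary_radial_projection yv subrr mul0r.
Qed.

Lemma segment_punctured x k : 0 < k -> k < 1 -> realization (point_link (supp p)) x ->
  geom (segment p x k) /\ segment p x k <> p.
Proof.
move=> k0 k1 Lx; have /realizationP[_ _] := Lx.
rewrite inE => /andP[xD /subsetPn[v vp vx]].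
split.
  apply: realization_segment => //; last by rewrite !ltW.
    apply: realizationS Lx; apply/subsetP=> A; rewrite inE => /andP[AD _].
    exact: Dcomplex AD (subsetUl _ _).
  by rewrite setUC.
move=> xp; have := bary_segment v p x k; rewrite xp (notin_supp vx) mulr0 addr0.
have := bary_center_gt0 vp; nra.
Qed.

Lemma min_ratio_segment x k : 0 < k -> realization (point_link (supp p)) x ->
  min_ratio (segment p x k) = 1 - k.
Proof.
move=> k0 /realizationP[x_ge0 _]; rewrite inE => /andP[_ /subsetPn[v vp /notin_supp vx]].
apply/eqP; rewrite eq_le; apply/andP; split.
  rewrite -(ler_pM2r (bary_center_gt0 vp)) (le_trans (min_ratio_le _ vp)) //.
  by rewrite bary_segment vx mulr0 addr0.
apply/bigmin_geP; split=> [|u up]; first by lra.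
by rewrite ler_pdivlMr ?bary_center_gt0 // bary_segment lerDl mulr_ge0 // ltW.
Qed.

Lemma segment_radialK x k : 0 < k -> realization (point_link (supp p)) x ->
  radial_projection (segment p x k) = x.
Proof.
move=> k0 Lx; apply: bary_inj => v; rewrite bary_radial_projection min_ratio_segment //.
rewrite bary_segment; field; rewrite (_ : 1 - (1 - k) = k) ?gt_eqF //; ring.
Qed.

Lemma min_ratio_continuous : continuous (min_ratio : 'rV[R]_#|V| -> R^o).
Proof.
apply: (@continuous_big R^o) => [|v _ y].
  by move=> z; apply: continuous_min; [exact: cvg_fst|exact: cvg_snd].
by apply: (continuousM (s := bary v)); [exact: bary_continuous|exact: cst_continuous].
Qed.

Lemma radial_projection_continuous :
  {within [set y | geom y /\ y <> p], continuous radial_projection}%classic.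
Proof.
apply/continuous_in_subspaceT => y /set_mem[Dy yp].
have min_ratio_cont := @min_ratio_continuous y.
apply: (continuousZ (s := fun y => (1 - min_ratio y)^-1)
  (f := fun y => y - min_ratio y *: p)); last first.
  apply: (continuousB (f := id)) => //; apply: (continuousZ (s := min_ratio)) => //.
  exact: cst_continuous.
apply: continuousV; first by rewrite gt_eqF // subr_gt0 min_ratio_lt1.
apply: (continuousB (V := R^o) (f := fun=> 1) (g := min_ratio)) => //.
exact: cst_continuous.
Qed.

Lemma null_puncture_point_link (L := realization (R := R) (point_link (supp p))) :
  null_puncture R geom p -> contractible_in R L L.
Proof.
move=> /(_ _ (supp_near p))[N pN].
have [k [k0 k1 segN]] := segment_near 2 pN.
apply: (contractible_in_retract (f := fun x => segment p x k) (g := radial_projection)).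
- apply/continuous_subspaceT/segment_continuous; [exact: cst_continuous|by move=> x U|].
  exact: cst_continuous.
- have cont := radial_projection_continuous.
  by apply: continuous_subspaceW cont => y [[Dy _] yp].
- move=> x Lx; have [Dx xp] := segment_punctured k0 k1 Lx; split=> //; split=> //.
  apply: segN; apply: le_trans (ler_normB _ _) _.
  have := realization_norm_le1 Dp; have := realization_norm_le1 Lx; lra.
- by move=> y [[Dy py] yp]; apply: radial_projection_link.
- by move=> x; apply: segment_radialK.
Qed.

End RadialProjection.

(** * Links of faces in balls and spheres *)

Lemma signr_cardsD (S : pzRingType) (V : finType) (B C : {set V}) : B \subset C ->
  (-1) ^+ #|C :\: B| = (-1) ^+ #|C| * (-1) ^+ #|B| :> S.
Proof.
move=> BC; rewrite -[in RHS](cardsID B C) (setIidPr BC) addnC exprD.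
by rewrite -mulrA -expr2 sqrr_sign mulr1.
Qed.

Lemma alternating_sum_toggle (V : finType) (v : V) (P : pred {set V}) :
  (forall G, P (v |: G) = P (G :\ v)) -> \sum_(G | P G) (-1) ^+ #|G| = 0 :> int.
Proof.
move=> P_v; pose toggle (G : {set V}) := if v \in G then G :\ v else v |: G.
have toggleK : involutive toggle.
  move=> G; rewrite /toggle; have [vG|vG] := boolP (v \in G).
    by rewrite setD11 setD1K.
  by rewrite setU11 setU1K.
have P_toggle G : P (toggle G) = P G.
  rewrite /toggle; case: ifPn => vG; first by rewrite -P_v (setUidPr _) ?sub1set.
  by rewrite P_v; congr P; apply/setDidPl; rewrite disjoint_sym disjoints1.
set S := \sum_(G | _) _; suff : S = - S by lra.
rewrite {1}/S (reindex_inj (inv_inj toggleK)) /= -sumrN; apply: eq_big => // G _.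
rewrite /toggle; case: ifPn => vG; last by rewrite cardsU1 vG exprS mulN1r.
by rewrite [in RHS](cardsD1 v) vG exprS mulN1r opprK.
Qed.

Definition link_euler (V : finType) (D : {set {set V}}) (s : {set V}) : int :=
  \sum_(G in D | s \subset G) (-1) ^+ #|G :\: s|.

Lemma link_euler_set0 (V : finType) (D : {set {set V}}) :
  link_euler D set0 = \sum_(G in D) (-1) ^+ #|G|.
Proof. by apply: eq_big => [G|G _]; rewrite ?sub0set ?andbT ?setD0. Qed.

Definition free_face (V : finType) (D : {set {set V}}) (s : {set V}) (v : V) :=
  [/\ v \notin s, v |: s \in D & forall G, G \in D -> s \subset G -> G \subset v |: s].

Section LinksOfFaces.
Variables (R : realType) (V : finType) (D : {set {set V}}).
Hypothesis Dcomplex : simplicial_complex D.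
Implicit Types (p : 'rV[R]_#|V|) (s : {set V}) (v : V).
Let geom : set 'rV[R]_#|V| := realization D.

(* Faces of the star of [s] that do not contain [s] form the contractible
   [point_link s]; all faces of the star cancel in pairs. *)
Lemma null_puncture_euler p :
  geom p -> null_puncture R geom p -> link_euler D (supp p) = 0.
Proof.
move=> Dp nullp; set s := supp p.
have [v vs] := set0Pn _ (supp_neq0 Dp).
have link0 := contractible_euler (@point_link_complex _ _ Dcomplex s)
  (null_puncture_point_link Dcomplex Dp nullp).
have star0 : \sum_(G : {set V} | G :|: s \in D) (-1) ^+ #|G| = 0 :> int.
  apply: (alternating_sum_toggle (v := v)) => G; congr (_ \in D); apply/setP=> u.
  by rewrite !in_setU in_setD1 in_set1; case: eqP => [->|]; rewrite ?vs ?orbT.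
have {star0 link0} above0 : \sum_(G in D | s \subset G) (-1) ^+ #|G| = 0 :> int.
  rewrite -[RHS]star0 [RHS](bigID (fun G : {set V} => s \subset G)) /=.
  rewrite [X in _ = _ + X](eq_bigl (fun G => G \in point_link D s)) => [|G]; last by rewrite inE.
  rewrite link0 addr0; apply: eq_bigl => G.
  case: (boolP (s \subset G)) => sG; rewrite ?andbF // !andbT.
  by rewrite (setUidPl sG).
transitivity (\sum_(G in D | s \subset G) (-1) ^+ #|G| * (-1) ^+ #|s| : int).
  by apply: eq_bigr => G /andP[_ sG]; rewrite signr_cardsD.
by rewrite -mulr_suml above0 mul0r.
Qed.

Lemma facet_not_null_puncture p : geom p ->
  (forall G, G \in D -> supp p \subset G -> G \subset supp p) -> ~ null_puncture R geom p.
Proof.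
move=> Dp facet /(null_puncture_euler Dp)/eqP; have /realizationP[_ _ pD] := Dp.
rewrite /link_euler (bigD1 (supp p)) ?pD ?subxx //= setDv cards0 expr0.
rewrite big1 ?addr0 ?oner_eq0 // => G /andP[/andP[GD pG]].
by rewrite eqEsubset pG andbT facet.
Qed.

(* Near [p] the complex is the simplex [v |: s], on whose boundary [p] lies. *)
Lemma free_face_null_puncture s v p : free_face D s v -> geom p -> supp p = s ->
  null_puncture R geom p.
Proof.
move=> [vs tD free] Dp ps; set t := v |: s in tD free.
apply: (null_puncture_local (A := realization (powerset t)) (supp_near p)) => [x px|].
  split.
    by apply: realizationS; apply/subsetP=> A; rewrite powersetE; apply: Dcomplex.
  move=> /realizationP[x_ge0 x_sum1 xD]; apply/realizationP; split=> //.
  by rewrite powersetE free // -ps.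
have pt : realization (powerset t) p.
  have /realizationP[p_ge0 p_sum1 _] := Dp; apply/realizationP; split=> //.
  by rewrite powersetE ps subsetUr.
apply: (convex_null_puncture (l := bary v) (c := corner R v)) => //.
- exact: realization_powerset_convex.
- by apply: realization_corner; rewrite setU11.
- by rewrite /= notin_supp ?ps // bary_corner eqxx.
- by move=> x /realizationP[x_ge0 _ _]; rewrite /= notin_supp ?ps.
Qed.

End LinksOfFaces.

Section UnitBall.
Variables (R : realType) (n : nat).
Implicit Types p q x y u : 'rV[R]_n.

Definition dot x y : R := \sum_i x ord0 i * y ord0 i.

Lemma dotC x y : dot x y = dot y x.
Proof. by apply: eq_bigr => i _; rewrite mulrC. Qed.

Lemma dot_is_linear x : scalar (dot x).
Proof.
move=> a y u; rewrite /dot mulr_sumr -big_split; apply: eq_bigr => i _ /=.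
by rewrite !mxE mulrDr mulrCA.
Qed.
HB.instance Definition _ x :=
  GRing.isLinear.Build R 'rV[R]_n R *%R (dot x) (dot_is_linear x).

Lemma dotZr a x y : dot x (a *: y) = a * dot x y.
Proof. exact: linearZ. Qed.

Lemma dot_ge0 x : 0 <= dot x x.
Proof. by apply: sumr_ge0 => i _; rewrite -expr2 sqr_ge0. Qed.

Lemma dot_eq0 x : (dot x x == 0) = (x == 0).
Proof.
apply/idP/eqP => [/eqP xx0|->]; last by rewrite linear0.
apply/rowP => i; rewrite mxE; apply/eqP; rewrite -sqrf_eq0 expr2; apply/eqP.
apply: (psumr_eq0P (F := fun i => x ord0 i * x ord0 i) _ xx0) => // j _.
by rewrite -expr2 sqr_ge0.
Qed.

Lemma dot_gt0 x : x != 0 -> 0 < dot x x.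
Proof. by move=> x0; rewrite lt_def dot_ge0 dot_eq0 x0. Qed.

Lemma dotBB x y : dot (x - y) (x - y) = dot x x - 2 * dot x y + dot y y.
Proof. by rewrite linearB /= ![dot (x - y) _]dotC !linearB /= (dotC y x); ring. Qed.

Lemma dot_segment x y t : dot (segment x y t) (segment x y t) =
  (1 - t) * dot x x + t * dot y y - t * (1 - t) * dot (x - y) (x - y).
Proof.
rewrite (segment_form (dot (segment x y t))) /= ![dot (segment x y t) _]dotC.
by rewrite !segment_form /= dotBB (dotC y x); ring.
Qed.

Lemma dot_continuous : continuous (fun x => dot x x : R^o).
Proof.
apply: (@continuous_big R^o) => [|i _ x]; first exact: add_continuous.
by apply: continuousM; apply: coord_continuous.
Qed.

Lemma unit_ballE x : unit_ball x = (dot x x <= 1).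
Proof. by rewrite /unit_ball /dot /=; under eq_bigr do rewrite expr2. Qed.

Lemma unit_sphereE x : unit_sphere x = (dot x x = 1).
Proof. by rewrite /unit_sphere /dot /=; under eq_bigr do rewrite expr2. Qed.

Lemma unit_ball0 : @unit_ball R n 0.
Proof. by rewrite unit_ballE linear0 ler01. Qed.

Lemma unit_ball_convex : convex (@unit_ball R n).
Proof.
move=> x y t; rewrite !unit_ballE dot_segment => x1 y1 /andP[t0 t1].
have := dot_ge0 (x - y); have : 0 <= t * (1 - t) by rewrite mulr_ge0 // subr_ge0.
nra.
Qed.

Lemma unit_ball_boundary_null_puncture p :
  dot p p = 1 -> null_puncture R (@unit_ball R n) p.
Proof.
move=> p1; pose l : {scalar 'rV[R]_n} := dot (- p).
have lE x : l x = - dot p x by rewrite /l /= dotC linearN /= dotC.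
apply: (convex_null_puncture (l := l) (c := 0)) unit_ball_convex _ unit_ball0 _ _.
- by rewrite unit_ballE p1.
- by rewrite linear0 lE p1 ltrN10.
move=> x; rewrite unit_ballE => x1; rewrite !lE lerN2 p1.
by have := dot_ge0 (x - p); rewrite dotBB (dotC x p) p1; lra.
Qed.

Lemma near_dot_lt1 p : dot p p < 1 -> \forall x \near p, dot x x < 1.
Proof. move=> p1; exact: (cvgr_lt (dot p p)) (@dot_continuous p) _ p1. Qed.

Lemma unit_ball_interior_null_puncture p q : dot p p < 1 -> dot q q < 1 ->
  null_puncture R (@unit_ball R n) q -> null_puncture R (@unit_ball R n) p.
Proof.
have interior x : dot x x < 1 -> nbhs x (@unit_ball R n).
  by move/near_dot_lt1; apply: (@filterS _ (nbhs x)) => y /ltW; rewrite unit_ballE.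
move=> /interior/(null_puncture_interior R) ballp.
move=> /interior/(null_puncture_interior R) ballq.
by move=> /ballq/(translation_null_puncture (p := p))/ballp.
Qed.

(* The reflection exchanging [p] and [q] is a homeomorphism of the sphere. *)
Lemma unit_sphere_null_puncture p q : dot p p = 1 -> dot q q = 1 ->
  null_puncture R (@unit_sphere R n) q -> null_puncture R (@unit_sphere R n) p.
Proof.
move=> p1 q1; have [->//|pq] := eqVneq p q; pose u := p - q.
have u0 : 0 < dot u u by apply: dot_gt0; rewrite subr_eq0.
pose f x := x - (2 * dot u x / dot u u) *: u.
have uf x : dot u (f x) = - dot u x.
  by rewrite /f linearB linearZ /=; field; rewrite gt_eqF.
have fK x : f (f x) = x.
  by rewrite {1}/f uf /f -addrA -opprD -scalerDl mulrN mulNr subrr scale0r oppr0 addr0.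
have fS x : unit_sphere x -> unit_sphere (f x).
  rewrite !unit_sphereE => <-; rewrite /f dotBB !dotZr [dot (_ *: u) u]dotC.
  by rewrite dotZr (dotC x u); field; rewrite gt_eqF.
have fp : f p = q.
  have uu : dot u u = 2 * dot u p.
    by rewrite /u dotBB [dot (p - q) p]dotC linearB /= p1 q1; ring.
  by rewrite /f -uu divff ?gt_eqF // scale1r subKr.
have cf : {within @unit_sphere R n, continuous f}%classic.
  apply: continuous_subspaceT => x; apply: (continuousB (f := id)) => //.
  apply: (continuousZr_tmp (s := fun x => 2 * dot u x / dot u u)).
  have cu : {for x, continuous (dot u : 'rV[R]_n -> R^o)}.
    apply: (@continuous_big R^o) => [|i _ y]; first exact: add_continuous.
    by apply: continuousM; [exact: cst_continuous|exact: coord_continuous].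
  apply: continuousM; last exact: cst_continuous.
  by apply: continuousM cu; exact: cst_continuous.
have hom : homeo_on (@unit_sphere R n) (@unit_sphere R n) f f by [].
by rewrite -fp; apply: homeo_on_null_puncture hom _; rewrite unit_sphereE.
Qed.

Lemma unit_sphere_not_singleton p : unit_sphere p -> exists2 q, unit_sphere q & q <> p.
Proof.
rewrite unit_sphereE => p1; exists (- p).
  by rewrite unit_sphereE linearN /= dotC linearN /= opprK.
move=> Npp; have : dot p (- p) = 1 by rewrite Npp.
by rewrite linearN /= p1 => /eqP; rewrite lt_eqF // (lt_trans (ltrN10 R) ltr01).
Qed.

End UnitBall.

Section HomeomorphicToBallOrSphere.
Variables (R : realType) (T : topologicalType) (n : nat) (A : set T).
Variables (f : T -> 'rV[R]_n) (g : 'rV[R]_n -> T).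
Implicit Types x p q : T.

Lemma sphere_homogeneous p q : homeo_on A (@unit_sphere R n) f g -> A p -> A q ->
  null_puncture R A q -> null_puncture R A p.
Proof.
move=> fg Ap Aq nullq; have [_ _ AS _ [fK _]] := fg.
apply: (homeo_on_null_puncture fg Ap).
apply: (@unit_sphere_null_puncture _ _ _ (f q)); rewrite -?unit_sphereE; try exact: AS.
by apply: homeo_on_null_puncture (homeo_on_sym fg) (AS q Aq) _; rewrite fK.
Qed.

Hypothesis fg : homeo_on A (@unit_ball R n) f g.

Lemma ball_contractible : contractible_in R A A.
Proof.
apply: homeo_on_contractible fg _.
exact: convex_contractible (@unit_ball_convex _ _) (@unit_ball0 R n).
Qed.

Lemma ball_null_punctureP q p : A q -> ~ null_puncture R A q -> A p ->
  null_puncture R A p <-> dot (f p) (f p) = 1.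
Proof.
move=> Aq not_null Ap; have [_ _ AB _ [fK _]] := fg.
have boundary_null x : A x -> dot (f x) (f x) = 1 -> null_puncture R A x.
  move=> Ax /unit_ball_boundary_null_puncture; exact: homeo_on_null_puncture fg Ax.
split=> [nullp|]; last exact: boundary_null.
have interior x : A x -> ~ dot (f x) (f x) = 1 -> dot (f x) (f x) < 1.
  by move=> /AB; rewrite unit_ballE le_eqVlt => /predU1P[].
have fq1 : dot (f q) (f q) < 1 by apply: interior => // /(boundary_null _ Aq).
have [//|/(interior p Ap) fp1] := pselect (dot (f p) (f p) = 1).
case: not_null; apply: homeo_on_null_puncture fg Aq _.
apply: (unit_ball_interior_null_puncture fq1 fp1).
by apply: homeo_on_null_puncture (homeo_on_sym fg) (AB p Ap) _; rewrite fK.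
Qed.

Lemma ball_null_puncture_closed q p : A q -> ~ null_puncture R A q -> A p ->
  (forall U, nbhs p U -> exists x, [/\ A x, U x & null_puncture R A x]) ->
  null_puncture R A p.
Proof.
move=> Aq not_null Ap limit_null; have nullP := ball_null_punctureP Aq not_null.
have [/subspace_continuousP/(_ p Ap) cf _ AB _ _] := fg.
apply/nullP => //; have := AB p Ap; rewrite unit_ballE le_eqVlt => /predU1P[//|fp1].
have [x [Ax fx1 /(nullP x Ax)]] := limit_null _ (cf _ (near_dot_lt1 fp1)).
have : dot (f x) (f x) < 1 by apply: fx1.
by move=> + fx; rewrite fx ltxx.
Qed.

End HomeomorphicToBallOrSphere.

Section BallOrSphere.
Variables (R : realType) (V : finType) (D : {set {set V}}).
Hypothesis Dcomplex : simplicial_complex D.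
Implicit Types (s r : {set V}) (v : V).
Let geom : set 'rV[R]_#|V| := realization D.

Lemma free_face_interior_not_null s v : free_face D s v ->
  ~ null_puncture R geom (barycenter R (v |: s)).
Proof.
move=> [vs tD free]; have t0 := setU1_neq0 v s.
apply: facet_not_null_puncture => //; first exact: realization_barycenter.
rewrite supp_barycenter // => G GD tG; apply: free => //.
exact: subset_trans (subsetUr _ _) tG.
Qed.

Lemma free_vertex_geom v x : free_face D set0 v -> geom x -> x = corner R v.
Proof.
move=> [_ vD free] /realizationP[x_ge0 x_sum1 xD].
have xv u : u != v -> bary u x = 0.
  move=> uv; apply: notin_supp.
  have := free _ xD (sub0set _); rewrite setU0 => /subsetP xv.
  by apply: contra uv => /xv; rewrite inE.
apply: bary_inj => u; rewrite bary_corner; have [->|/xv//] := eqVneq u v.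
by rewrite -x_sum1 (bigD1 v) //= big1 ?addr0 // => w /xv.
Qed.

Lemma sphere_no_free_face n s v :
  homeomorphic geom (@unit_sphere R n) -> ~ free_face D s v.
Proof.
move=> [f [g fg]] free; have [vs tD _] := free.
have Dq := realization_barycenter R (setU1_neq0 v s) tD.
have [s0|s0] := eqVneq s set0; last first.
  have Dp : geom (barycenter R s).
    by apply: realization_barycenter => //; apply: Dcomplex tD (subsetUr _ _).
  apply: (free_face_interior_not_null free); apply: (sphere_homogeneous fg Dq Dp).
  exact: (free_face_null_puncture Dcomplex free Dp (supp_barycenter R s0)).
rewrite s0 in free; have [_ _ AS SA [_ gK]] := fg.
have [y Sy] := unit_sphere_not_singleton (AS _ Dq); apply.
by rewrite -[LHS]gK // (free_vertex_geom free (SA y Sy)) (free_vertex_geom free Dq).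
Qed.

Theorem free_face_link_euler s r v : is_ball_or_sphere R D -> free_face D r v ->
  s \subset r -> link_euler D s = 0.
Proof.
move=> ball_or_sphere free sr; have [vr tD _] := free.
case: ball_or_sphere => -[n]; last by move/sphere_no_free_face/(_ free).
move=> [f [g fg]]; have [s0|s0] := eqVneq s set0.
  rewrite s0 link_euler_set0.
  exact: (contractible_euler Dcomplex (ball_contractible fg)).
have rD : r \in D by apply: Dcomplex tD (subsetUr _ _).
have sD : s \in D by apply: Dcomplex rD sr.
have r0 : r != set0 by apply: contraNneq s0 => r0; rewrite -subset0 -r0.
have Ds := realization_barycenter R s0 sD; have Dr := realization_barycenter R r0 rD.
rewrite -(supp_barycenter R s0); apply: (null_puncture_euler Dcomplex Ds).
apply: (ball_null_puncture_closed fg (realization_barycenter R (setU1_neq0 v r) tD)) => //.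
  exact: free_face_interior_not_null.
move=> U pU; have [k [k0 k1 /(_ _ (lexx _)) Uk]] :=
  segment_near `|barycenter R s - barycenter R r| pU.
have supp_union : supp (barycenter R s) :|: supp (barycenter R r) = r.
  by rewrite !supp_barycenter //; apply/setUidPr.
have Dx : geom (segment (barycenter R s) (barycenter R r) k).
  by apply: realization_segment; rewrite ?supp_union ?ltW.
exists (segment (barycenter R s) (barycenter R r) k); split=> //.
apply: (free_face_null_puncture Dcomplex free) => //.
by rewrite (supp_segment Ds Dr).
Qed.

End BallOrSphere.

(** * The K-polynomial of a Stanley-Reisner ring *)

Lemma prodr_1B (S : comPzRingType) (V : finType) (H : {set V}) (x : V -> S) :
  \prod_(v in H) (1 - x v) =
  \sum_(A : {set V} | A \subset H) (-1) ^+ #|A| * \prod_(v in A) x v.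
Proof.
rewrite big_mkcond /=.
transitivity (\prod_v ((if v \in H then - x v else 0) + 1)).
  by apply: eq_bigr => v _; case: ifP; rewrite ?add0r // addrC.
rewrite bigA_distr (bigID (fun A : {set V} => A \subset H)) /= [X in _ + X]big1 => [|A].
  rewrite addr0; apply: eq_bigr => A AH; rewrite -big_mkcond /= -prodrN.
  by apply: eq_bigr => v /(subsetP AH) ->.
by case/subsetPn=> v vA vH; rewrite (bigD1 v) //= vA (negbTE vH) mul0r.
Qed.

(* Expanding [1 - u] on the faces collects the faces containing a given set. *)
Lemma sum_faces_link_euler (S : comPzRingType) (V : finType) (D : {set {set V}})
    (u : V -> S) :
  \sum_(G in D) (\prod_(v in G) (1 - u v)) * \prod_(v in ~: G) u v =
  \sum_(H : {set V}) (\prod_(v in H) u v) *~ link_euler D (~: H).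
Proof.
transitivity (\sum_(G in D) \sum_(H : {set V} | ~: H \subset G)
    (-1) ^+ #|G :\: ~: H| * \prod_(v in H) u v); last first.
  rewrite (exchange_big_dep xpredT) //=; apply: eq_bigr => H _.
  rewrite /link_euler -mulrzl rmorph_sum mulr_suml /=; apply: eq_bigr => G _.
  by rewrite rmorph_sign.
apply: eq_bigr => G GD; rewrite prodr_1B mulr_suml.
rewrite [RHS](reindex_onto (fun B => B :|: ~: G) (fun H => H :&: G)) => [|H] /=; last first.
  by rewrite subCset => /setUidPl GH; rewrite setUIl setUCr setIT.
have interG B : (B :|: ~: G) :&: G = B :&: G.
  by rewrite setIUl [~: G :&: G]setIC setICr setU0.
apply: eq_big => [B|B /setIidPl BG].
  by rewrite interG setCU setCK subsetIr; apply/idP/eqP => /setIidPl.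
rewrite setDE setCK setIC interG BG -mulrA; congr (_ * _).
rewrite -bigU /=; first by apply: eq_bigl => v; rewrite !inE.
by rewrite -subsets_disjoint; apply/setIidPl.
Qed.

Lemma has_dim_mod_line (k : fieldType) (M : lmodType k) (J : M -> Prop) (x : M)
    (d : nat) :
  J 0 -> (forall c y, J y -> J (c *: y)) ->
  has_dim_mod (fun y => exists c, y = c *: x) J d <-> d = ~~ `[< J x >].
Proof.
move=> J0 JZ; split=> [[b [b_line free_b span_b]]|->]; last first.
  case: asboolP => [Jx|nJx] /=.
    exists (fun=> 0); split=> [[]//|c _ []//|_ [c ->]].
    by exists (fun=> 0); rewrite big_ord0 subr0; apply: JZ.
  exists (fun=> x); split=> [_|c|_ [c ->]]; first by exists 1; rewrite scale1r.
    rewrite big_ord1 => Jcx i; rewrite ord1; apply/eqP; apply: contra_notT nJx => c0.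
    by rewrite -[x](scalerK c0); apply: JZ.
  by exists (fun=> c); rewrite big_ord1 subrr.
have b_notin i : ~ J (b i).
  have -> : b i = \sum_j (j == i)%:R *: b j.
    by rewrite (bigD1 i) //= eqxx scale1r big1 ?addr0 // => j /negbTE ->; rewrite scale0r.
  by move=> /free_b/(_ i)/eqP; rewrite eqxx oner_eq0.
have [Jx|nJx] := asboolP (J x) => /=.
  case: d b b_line {free_b span_b} b_notin => // d b b_line b_notin.
  by have [c bE] := b_line ord0; case: (b_notin ord0); rewrite bE; apply: JZ.
case: d b b_line free_b span_b b_notin => [|[//|d]] b b_line free_b span_b b_notin.
  case: nJx; have [|c] := span_b x; first by exists 1; rewrite scale1r.
  by rewrite big_ord0 subr0.
pose i1 : 'I_d.+2 := lift ord0 ord0.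
have [[c0 b0E] [c1 b1E]] := (b_line ord0, b_line i1).
pose c (i : 'I_d.+2) : k := if i == ord0 then c1 else if i == i1 then - c0 else 0.
have /free_b/(_ ord0) : J (\sum_i c i *: b i).
  rewrite !big_ord_recl big1 ?addr0 => [|i _]; last by rewrite /c /= scale0r.
  by rewrite /c /= b0E b1E !scalerA -scalerDl mulNr mulrC subrr scale0r.
rewrite /c eqxx => c10; case: (b_notin i1); rewrite b1E c10 scale0r; exact: J0.
Qed.

Section HilbertSeries.
Variables (k : fieldType) (V : finType) (D : {set {set V}}).
Hypothesis Dcomplex : simplicial_complex D.
Implicit Types (a m : 'X_{1..#|V|}) (A G : {set V}).

Definition squarefree_mnm A : 'X_{1..#|V|} :=
  [multinom (enum_val i \in A : nat) | i < #|V|].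

Definition mnm_supp a : {set V} := [set v | a (enum_rank v) != 0%N].

Lemma squarefree_mnmE A v : squarefree_mnm A (enum_rank v) = (v \in A).
Proof. by rewrite mnmE enum_rankK. Qed.

Lemma eq_mnm a m : (forall v, a (enum_rank v) = m (enum_rank v)) -> a = m.
Proof. by move=> am; apply/mnmP => i; rewrite -(enum_valK i). Qed.

Lemma squarefree_mnmK : cancel squarefree_mnm mnm_supp.
Proof. by move=> A; apply/setP=> v; rewrite inE squarefree_mnmE; case: (v \in A). Qed.

Lemma squarefree_mnm_le A a : (squarefree_mnm A <= a)%MM = (A \subset mnm_supp a).
Proof.
apply/mnm_lepP/subsetP => [le_a v vA|Aa i].
  by rewrite inE; have := le_a (enum_rank v); rewrite squarefree_mnmE vA; case: (a _).
rewrite -(enum_valK i) squarefree_mnmE; have [/Aa|//] := boolP (_ \in A).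
by rewrite inE; case: (a _).
Qed.

Lemma prod_var (S : comNzRingType) A : \prod_(v in A) var S v = 'X_[squarefree_mnm A].
Proof.
have -> : squarefree_mnm A = (\sum_(v in A) U_(enum_rank v))%MM; last first.
  by elim/big_ind2: _ => // [|x m y a -> ->]; rewrite ?mpolyX0 ?mpolyXD.
apply: eq_mnm => u; rewrite squarefree_mnmE mnm_sumE.
under eq_bigr => v _ do rewrite mnm1E (inj_eq enum_rank_inj).
have [uA|uA] := boolP (u \in A).
  by rewrite (bigD1 u) //= eqxx big1 // => v /andP[_ /negbTE ->].
by rewrite big1 // => v vA; case: eqP => // vu; rewrite -vu vA in uA.
Qed.

Lemma stanley_reisner_monomial a :
  stanley_reisner_ideal (k := k) D 'X_[a] <-> mnm_supp a \notin D.
Proof.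
split=> [[q qE]|aD].
  apply/negP=> aD; have := mcoeffX k a a; rewrite qE eqxx raddf_sum big1 /=.
    by move/eqP; rewrite eq_sym oner_eq0.
  move=> G GD; rewrite prod_var mcoeffM big1 // => -[m1 m2] /= /eqP aE; rewrite mcoeffX.
  case: eqP => [GE|]; last by rewrite mulr0.
  case/negP: GD; apply: Dcomplex aD _; rewrite -squarefree_mnm_le GE.
  by apply/mnm_lepP => i; have /mnmP/(_ i) -> := aE; rewrite mnmDE leq_addl.
exists (fun G => if G == mnm_supp a then 'X_[a - squarefree_mnm G] else 0).
rewrite (bigD1 (mnm_supp a)) //= eqxx prod_var big1 => [|G /andP[_ /negbTE->]]; last first.
  by rewrite mul0r.
by rewrite addr0 -mpolyXD submK // squarefree_mnm_le.
Qed.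

Lemma stanley_reisner0 : stanley_reisner_ideal (k := k) D 0.
Proof. by exists (fun=> 0); rewrite big1 // => G _; rewrite mul0r. Qed.

Lemma stanley_reisnerZ c (p : polyring k V) :
  stanley_reisner_ideal D p -> stanley_reisner_ideal D (c *: p).
Proof.
move=> [q ->]; exists (fun G => c *: q G); rewrite scaler_sumr.
by apply: eq_bigr => G _; rewrite scalerAl.
Qed.

Lemma hilbert_functionP h : is_hilbert_function (stanley_reisner_ideal (k := k) D) h <->
  forall a, h a = (mnm_supp a \in D).
Proof.
have dimP a : has_dim_mod (graded_piece (k := k) a) (stanley_reisner_ideal D) (h a) <->
    h a = (mnm_supp a \in D).
  apply: iff_trans (has_dim_mod_line _ _ stanley_reisner0 stanley_reisnerZ) _.
  by rewrite (asbool_equiv_eq (stanley_reisner_monomial a)) asboolb negbK.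
by split=> hP a; apply/dimP.
Qed.

Lemma mcoeff_signX n a m : ((-1) ^+ n * 'X_[a] : polyring int V)@_m = (-1) ^+ n * (a == m)%:R.
Proof.
rewrite -[in LHS]signr_odd -[in RHS]signr_odd !mulr_sign.
by case: (odd n); rewrite ?mcoeffN mcoeffX.
Qed.

Lemma coef_prod_1B_var A m :
  (\prod_(v in A) (1 - var int v))@_m =
  \sum_(B : {set V} | B \subset A) (-1) ^+ #|B| * (squarefree_mnm B == m)%:R.
Proof.
rewrite prodr_1B raddf_sum; apply: eq_bigr => B _ /=.
by rewrite prod_var mcoeff_signX.
Qed.

Lemma series_mul_prod_1B_var (f : 'X_{1..#|V|} -> int) m :
  series_mul f (fun a => (\prod_(v : V) (1 - var int v))@_a) m =
  \sum_(A : {set V} | A \subset mnm_supp m) (-1) ^+ #|A| * f (m - squarefree_mnm A)%MM.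
Proof.
have coefE a : (\prod_(v : V) (1 - var int v))@_a =
    \sum_(A : {set V}) (-1) ^+ #|A| * (squarefree_mnm A == a)%:R.
  have -> : \prod_(v : V) (1 - var int v) = \prod_(v in [set: V]) (1 - var int v).
    by apply: eq_bigl => v; rewrite inE.
  by rewrite coef_prod_1B_var; apply: eq_bigl => A; rewrite subsetT.
rewrite /series_mul; under [LHS]eq_bigr => c _ do rewrite coefE mulr_sumr.
rewrite exchange_big /= [RHS]big_mkcond /=; apply: eq_bigr => A _.
rewrite -squarefree_mnm_le; case: ifP => Am.
  have lt1 : (mdeg (m - squarefree_mnm A) < (mdeg m).+1)%N by rewrite ltnS mdegB.
  have lt2 : (mdeg (squarefree_mnm A) < (mdeg m).+1)%N.
    by rewrite ltnS -(submK Am) mdegD leq_addl.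
  rewrite (bigD1 (BMultinom lt1, BMultinom lt2)) /=; last by rewrite submK.
  rewrite eqxx mulr1 mulrC big1 ?addr0 // => -[c1 c2] /= /andP[/eqP mE ne_c].
  case: eqP => AE; rewrite ?mulr0 ?mulr1 //; case/eqP: ne_c.
  congr pair; apply/val_inj => /=; last by rewrite AE.
  by rewrite AE [X in (X - _)%MM]mE addmK.
rewrite big1 // => -[c1 c2] /= /eqP mE; case: eqP => AE; rewrite ?mulr0 //.
case/negP: Am; rewrite AE; apply/mnm_lepP => i.
by have /mnmP/(_ i) -> := mE; rewrite mnmDE leq_addl.
Qed.

Definition squarefree_coef m : int := if m == squarefree_mnm (mnm_supp m)
  then \sum_(G in D | G \subset mnm_supp m) (-1) ^+ #|mnm_supp m :\: G| else 0.

Lemma coef_sum_faces m :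
  (\sum_(G in D) (\prod_(v in G) var int v) * \prod_(v in ~: G) (1 - var int v))@_m =
  squarefree_coef m.
Proof.
have coefG G : ((\prod_(v in G) var int v) * \prod_(v in ~: G) (1 - var int v))@_m =
    \sum_(A : {set V} | G \subset A) (-1) ^+ #|A :\: G| * (squarefree_mnm A == m)%:R.
  rewrite prodr_1B mulr_sumr raddf_sum.
  rewrite [RHS](reindex_onto (fun B => G :|: B) (fun A => A :\: G)) => [|A GA] /=; last first.
    by rewrite setUC -{2}(setIidPr GA) setUC setID.
  apply: eq_big => [B|B BG].
    by rewrite subsetUl setDUl setDv set0U -disjoints_subset; apply/idP/eqP => /setDidPl.
  have GB : [disjoint G & B] by rewrite disjoint_sym disjoints_subset.
  have -> : (G :|: B) :\: G = B.
    by rewrite setDUl setDv set0U; apply/setDidPl; rewrite disjoint_sym.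
  rewrite -mcoeff_signX -prod_var mulrCA -bigU //=; congr (_ * _)@__.
  by apply: eq_bigl => v; rewrite !inE.
rewrite raddf_sum /=; under eq_bigr => G _ do rewrite coefG.
rewrite (exchange_big_dep xpredT) //= /squarefree_coef; case: eqP => [mE|not_sqfree].
  rewrite (bigD1 (mnm_supp m)) //= [X in _ + X]big1 => [|A Am].
    by rewrite addr0; apply: eq_bigr => G _; rewrite -mE eqxx mulr1.
  rewrite big1 // => G _; case: eqP => [AE|]; last by rewrite mulr0.
  by rewrite -AE squarefree_mnmK eqxx in Am.
rewrite big1 // => A _; rewrite big1 // => G _; case: eqP => [AE|]; last by rewrite mulr0.
by case: not_sqfree; rewrite -AE squarefree_mnmK.
Qed.

Lemma hilbert_numerator_coef m :
  \sum_(A : {set V} | A \subset mnm_supp m)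
    (-1) ^+ #|A| * (mnm_supp (m - squarefree_mnm A) \in D)%:Z = squarefree_coef m.
Proof.
have suppB A v :
    (v \in mnm_supp (m - squarefree_mnm A)) = ((v \in A) < m (enum_rank v))%N.
  by rewrite inE mnmBE squarefree_mnmE subn_eq0 ltnNge.
rewrite /squarefree_coef; set s := mnm_supp m; case: eqP => [mE|not_sqfree].
  rewrite [RHS](reindex_onto (fun A => s :\: A) (fun G => s :\: G)) /=; last first.
    move=> G /andP[_ Gs]; by rewrite setDDr setDv set0U; apply/setIidPr.
  rewrite big_mkcond [RHS]big_mkcond; apply: eq_bigr => A _ /=.
  rewrite subsetDl andbT setDDr setDv set0U.
  have -> : (s :&: A == A) = (A \subset s) by apply/eqP/setIidPr.
  have [As|_] := boolP (A \subset s); last by rewrite andbF.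
  rewrite andbT (setIidPr As) (_ : mnm_supp (m - squarefree_mnm A) = s :\: A).
    by case: (_ \in D); rewrite ?mulr1 ?mulr0.
  apply/setP=> v; rewrite suppB {1}mE squarefree_mnmE in_setD.
  by case: (v \in A); case: (v \in s).
have [v v2] : exists v, (1 < m (enum_rank v))%N.
  have [//|no_v] := pselect (exists v, (1 < m (enum_rank v))%N); case: not_sqfree.
  apply: eq_mnm => v; rewrite squarefree_mnmE inE.
  have : ~~ (1 < m (enum_rank v))%N by apply/negP => v2; apply: no_v; exists v.
  by case: (m _) => [|[]].
under eq_bigr => A _ do rewrite -natz mulr_natr mulrb.
rewrite -big_mkcondr /=.
apply: (alternating_sum_toggle (v := v)) => A; congr (_ && (_ \in D)).
  have vs : v \in mnm_supp m by rewrite inE -lt0n ltnW.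
  by rewrite subUset sub1set vs subDset (setUidPr _) // sub1set.
apply/setP=> u; rewrite !suppB !inE; case: (u =P v) => [->|] //=.
by case: (v \in A); rewrite ?v2 ?(ltnW v2).
Qed.

Theorem K_polynomialP (K : polyring int V) :
  is_K_polynomial (stanley_reisner_ideal (k := k) D) K <->
  K = \sum_(H : {set V}) (\prod_(v in H) (1 - var int v)) *~ link_euler D (~: H).
Proof.
have <- : \sum_(G in D) (\prod_(v in G) var int v) * \prod_(v in ~: G) (1 - var int v) =
    \sum_(H : {set V}) (\prod_(v in H) (1 - var int v)) *~ link_euler D (~: H).
  rewrite -sum_faces_link_euler; apply: eq_bigr => G _; congr (_ * _).
  by apply: eq_bigr => v _; rewrite subKr.
have numeratorE m : series_mul (fun a => (mnm_supp a \in D : nat)%:Z)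
    (fun a => (\prod_(v : V) (1 - var int v))@_a) m = squarefree_coef m.
  by rewrite series_mul_prod_1B_var hilbert_numerator_coef.
split=> [[h /hilbert_functionP hE hK]|->]; last first.
  exists (fun a => (mnm_supp a \in D : nat)) => [|m]; first exact/hilbert_functionP.
  by rewrite numeratorE coef_sum_faces.
apply/mpolyP => m; rewrite -hK coef_sum_faces -numeratorE /series_mul.
by apply: eq_bigr => c _; rewrite hE.
Qed.

End HilbertSeries.

(** * Tableau complexes *)

Lemma sum_subsets_sign (Y : finType) (C : {set Y}) : C != set0 ->
  \sum_(B : {set Y} | B \subset C) (-1) ^+ #|B| = 0 :> int.
Proof.
move=> C0; have := prodr_1B C (fun=> 1 : int); rewrite subrr prodr_const expr0n cards_eq0.
rewrite (negbTE C0) => zeroE; rewrite -[RHS]/(false%:R : int) zeroE.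
by apply: eq_bigr => B _; rewrite big1 ?mulr1.
Qed.

Lemma sum_nonempty_subsets_sign (Y : finType) (C : {set Y}) : C != set0 ->
  \sum_(B : {set Y} | (B \subset C) && (B != set0)) (-1) ^+ #|C :\: B| =
  (-1) ^+ #|C|.-1 :> int.
Proof.
move=> C0; transitivity (\sum_(B : {set Y} | (B \subset C) && (B != set0))
    (-1) ^+ #|C| * (-1) ^+ #|B| : int).
  by apply: eq_bigr => B /andP[BC _]; rewrite signr_cardsD.
have := sum_subsets_sign C0; rewrite (bigD1 set0) ?sub0set //= cards0 expr0 -mulr_sumr.
move/eqP; rewrite addrC addr_eq0 => /eqP ->.
by rewrite mulrN1 -[in LHS](prednK (n := #|C|)) ?card_gt0 // exprS mulN1r opprK.
Qed.

Section SetValuedTableaux.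
Variables X Y : finType.
Implicit Types (F : {set X * Y}) (f g : {ffun X -> Y}) (T : {set {ffun X -> Y}}).

Lemma in_graph f e : (e \in graph f) = (e.2 == f e.1).
Proof. by apply/imsetP/eqP => [[x _ ->] //|]; case: e => x y /= ->; exists x. Qed.

Lemma graph_subP f F : reflect (forall x, (x, f x) \in F) (graph f \subset F).
Proof.
apply: (iffP subsetP) => [fF x|fF e]; first by apply: fF; rewrite in_graph.
by rewrite in_graph; case: e => x y /= /eqP ->.
Qed.

Lemma prod_entries (S : comPzRingType) F (u : X * Y -> S) :
  \prod_(x : X) \prod_(y in entries F x) u (x, y) = \prod_(e in F) u e.
Proof. by rewrite pair_big_dep /=; apply: eq_big => [[x y]|[x y] _] //=; rewrite inE. Qed.

Lemma sum_card_entries F : (\sum_(x : X) #|entries F x|)%N = #|F|.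
Proof.
rewrite -sum1_card; under eq_bigr => x _ do rewrite -sum1_card.
by rewrite pair_big_dep /=; apply: eq_bigl => -[x y] /=; rewrite inE.
Qed.

Definition row_full F := [forall x, entries F x != set0].

(* Rows can be chosen independently, so the sum factors over them. *)
Lemma sum_row_full_sign F : row_full F ->
  \sum_(F' : {set X * Y} | (F' \subset F) && row_full F') (-1) ^+ #|F :\: F'| =
  (-1) ^+ (#|F| - #|X|)%N :> int.
Proof.
move=> /forallP F0.
pose Q x := [pred B : {set Y} | (B \subset entries F x) && (B != set0)].
transitivity (\prod_x \sum_(B : {set Y} | Q x B) (-1) ^+ #|entries F x :\: B| : int).
  rewrite bigA_distr_big_dep.
  pose rows F' := [ffun x => entries F' x] : {ffun X -> {set Y}}.
  pose of_rows (r : {ffun X -> {set Y}}) := [set e : X * Y | e.2 \in r e.1].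
  rewrite (reindex rows) /=; last first.
    exists of_rows => [F' _|r _]; first by apply/setP=> -[x y]; rewrite inE /= ffunE inE.
    by apply/ffunP=> x; rewrite ffunE; apply/setP=> y; rewrite !inE.
  apply: eq_big => [F'|F' _].
    apply/andP/familyP => [[FF' /forallP F'0] x|F'_rows].
      rewrite unfold_in /= ffunE F'0 andbT; apply/subsetP=> y; rewrite !inE.
      exact: (subsetP FF').
    have rowP x : (entries F' x \subset entries F x) && (entries F' x != set0).
      by have := F'_rows x; rewrite unfold_in /= ffunE.
    split; last by apply/forallP=> x; have /andP[] := rowP x.
    apply/subsetP=> -[x y] e; have /andP[/subsetP/(_ y) + _] := rowP x.
    by rewrite !inE; apply.
  rewrite -sum_card_entries expr_sum; apply: eq_bigr => x _.
  congr (_ ^+ #|pred_of_set _|).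
  by apply/setP=> y; rewrite !inE ffunE !inE.
under eq_bigr => x _ do rewrite sum_nonempty_subsets_sign //.
rewrite -expr_sum -sum_card_entries -[X in (_ - X)%N]sum1_card; congr (_ ^+ _).
rewrite -sumnB => [|x _]; last by rewrite card_gt0.
by apply: eq_bigr => x _; rewrite subn1.
Qed.

Lemma adjacent_tableaux T F f g : f \in T -> g \notin T ->
  graph f \subset F -> graph g \subset F -> exists (h h' : {ffun X -> Y}) (w : X),
  [/\ h \in T, h' \notin T, graph h \subset F, graph h' \subset F
    & forall x, x != w -> h' x = h x].
Proof.
move=> fT gT /graph_subP fF /graph_subP gF.
pose mix (s : seq X) := [ffun x => if x \in s then g x else f x] : {ffun X -> Y}.
have mixF s : graph (mix s) \subset F.
  by apply/graph_subP => x; rewrite ffunE; case: ifP => _; [apply: gF|apply: fF].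
have : mix (enum X) \notin T.
  by rewrite (_ : mix _ = g) //; apply/ffunP=> x; rewrite ffunE mem_enum.
elim: (enum X) => [|w s IHs] wsT.
  by case/negP: wsT; rewrite (_ : mix _ = f) //; apply/ffunP=> x; rewrite ffunE.
have [sT|/IHs//] := boolP (mix s \in T).
exists (mix s), (mix (w :: s)), w; split=> // x xw.
by rewrite !ffunE inE (negbTE xw).
Qed.

End SetValuedTableaux.

Section TableauComplex.
Variables (X Y : finType) (T : {set {ffun X -> Y}}) (E : {set X * Y}).
Hypothesis tableaux_in_E : forall f, f \in T -> graph f \subset E.
Local Notation V := (vertex E).
Local Notation Delta := (tableau_complex T E).
Implicit Types (v : V) (G H : {set V}) (F : {set X * Y}) (f g h : {ffun X -> Y}).

Lemma cell_exists v : exists e, (e \in E) && (val v == E :\ e).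
Proof. by have /imsetP[e eE ->] := valP v; exists e; rewrite eE eqxx. Qed.

Definition cell v : X * Y := xchoose (cell_exists v).

Lemma cell_in v : cell v \in E.
Proof. by have /andP[] := xchooseP (cell_exists v). Qed.

Lemma val_cell v : val v = E :\ cell v.
Proof. by have /andP[_ /eqP] := xchooseP (cell_exists v). Qed.

Lemma cell_inj : injective cell.
Proof. by move=> u v uv; apply/val_inj; rewrite !val_cell uv. Qed.

Lemma val_cellE v e : e \in E -> val v = E :\ e -> cell v = e.
Proof.
move=> eE; rewrite val_cell => /setP/(_ e); rewrite !inE eqxx eE andbT => /negbFE/eqP.
by [].
Qed.

Lemma cell_surj e : e \in E -> exists v, cell v = e.
Proof.
move=> eE; have Ee : E :\ e \in [set E :\ e | e in E] by apply: imset_f.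
by exists (exist _ (E :\ e) Ee : V); apply: val_cellE.
Qed.

Lemma tvar_cell v : tvar E (cell v) = var int v.
Proof. by rewrite /tvar -val_cell valK. Qed.

Definition cells H : {set X * Y} := cell @: H.
Definition verts F : {set V} := [set v | cell v \in F].

Lemma in_cells v H : (cell v \in cells H) = (v \in H).
Proof. exact: (mem_imset _ _ cell_inj). Qed.

Lemma cells_sub H : cells H \subset E.
Proof. by apply/subsetP=> _ /imsetP[v _ ->]; apply: cell_in. Qed.

Lemma cellsS G H : (cells G \subset cells H) = (G \subset H).
Proof.
apply/idP/idP => [/subsetP GH|/imsetS->//].
by apply/subsetP=> v; rewrite -!in_cells; apply: GH.
Qed.

Lemma cellsD G H : cells G :\: cells H = cells (G :\: H).
Proof.
apply/setP=> e; apply/setDP/imsetP => [[/imsetP[v vG ->]]|[v /setDP[vG vH] ->]].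
  by rewrite in_cells => vH; exists v; rewrite // inE vH.
by rewrite !in_cells.
Qed.

Lemma cellsK : cancel cells verts.
Proof. by move=> H; apply/setP=> v; rewrite inE in_cells. Qed.

Lemma vertsK F : F \subset E -> cells (verts F) = F.
Proof.
move=> FE; apply/setP=> e; apply/imsetP/idP => [[v + ->]|eF]; first by rewrite inE.
by have [v ve] := cell_surj (subsetP FE _ eF); exists v; rewrite ?inE ve.
Qed.

Lemma faceP G : reflect (exists2 f, f \in T & forall v, v \in G -> cell v \notin graph f)
  (G \in Delta).
Proof.
have val_imset v F : (val v \in [set E :\ e | e in E :\: F]) = (cell v \notin F).
  apply/imsetP/idP => [[e /setDP[eE eF] /(val_cellE eE)->//]|cF].
  by exists (cell v); rewrite ?val_cell // inE cF cell_in.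
apply: (iffP imsetP) => [[F]|[f fT fG]].
  rewrite inE => /andP[FE /existsP[f /andP[fT fF]]] ->.
  exists f => // v; rewrite inE val_imset.
  by apply: contra; apply: (subsetP fF).
exists (E :\: cells G).
  rewrite inE subsetDl /=; apply/existsP; exists f; rewrite fT /=.
  apply/subsetP=> e ef; have eE := subsetP (tableaux_in_E fT) _ ef; rewrite inE eE andbT.
  have [v ve] := cell_surj eE; rewrite -ve in_cells; apply/negP => /fG.
  by rewrite ve ef.
by apply/setP=> v; rewrite inE val_imset inE in_cells cell_in andbT negbK.
Qed.

Lemma tableau_complex_simplicial : simplicial_complex Delta.
Proof.
move=> G H /faceP[f fT fG] HG; apply/faceP; exists f => // v vH.
by apply: fG; apply: (subsetP HG).
Qed.

Lemma face_complP G :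
  reflect (exists2 f, f \in T & graph f \subset cells (~: G)) (G \in Delta).
Proof.
apply: (iffP (faceP G)) => -[f fT fG]; exists f => //.
  apply/subsetP=> e ef; have [v ve] := cell_surj (subsetP (tableaux_in_E fT) _ ef).
  by rewrite -ve in_cells inE; apply/negP => /fG; rewrite ve ef.
by move=> v vG; apply/negP => /(subsetP fG); rewrite in_cells inE vG.
Qed.

Definition interior_tableau F := [&& F \subset E, row_full F
  & [forall f : {ffun X -> Y}, (graph f \subset F) ==> (f \in T)]].

Lemma face_compl_interior G H : interior_tableau (cells H) -> ~: H \subset G ->
  (G \in Delta) = row_full (cells (~: G)).
Proof.
move=> /and3P[_ _ /forallP H_T] HG; apply/face_complP/forallP.
  move=> [f fT /graph_subP fG] x; by apply/set0Pn; exists (f x); rewrite inE.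
move=> G_full; have entry x : exists y, (x, y) \in cells (~: G).
  by have /set0Pn[y] := G_full x; rewrite inE; exists y.
pose f : {ffun X -> Y} := [ffun x => xchoose (entry x)].
have fG : graph f \subset cells (~: G).
  by apply/graph_subP => x; rewrite ffunE; apply: (xchooseP (entry x)).
exists f => //; apply: (implyP (H_T f)); apply: subset_trans fG _.
by rewrite cellsS -setCS setCK.
Qed.

Lemma link_euler_interior H : interior_tableau (cells H) ->
  link_euler Delta (~: H) = (-1) ^+ (#|cells H| - #|X|)%N.
Proof.
move=> intH; have /and3P[_ H0 _] := intH; rewrite -sum_row_full_sign // /link_euler.
pose compl_cells (G : {set V}) := cells (~: G).
rewrite [RHS](reindex_onto compl_cells (fun F => ~: verts F)) /=; last first.
  move=> F /andP[FH _]; rewrite /compl_cells setCK vertsK //.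
  exact: subset_trans FH (cells_sub _).
apply: eq_big => [G|G /andP[_ HG]].
  rewrite /compl_cells cellsK setCK eqxx andbT cellsS -setCS setCK andbC.
  by have [/(face_compl_interior intH)|] := boolP (~: H \subset G).
by rewrite /compl_cells cellsD (card_imset _ cell_inj) !setDE !setCK setIC.
Qed.

(* The two tableaux give a ridge of the complex, and the facet complementary to [h]
   is the only one above it, since a tableau in their union is one of them. *)
Lemma adjacent_free_face h h' w : h \in T -> h' \notin T -> graph h' \subset E ->
  (forall x, x != w -> h' x = h x) ->
  exists v, free_face Delta (~: verts (graph h :|: graph h')) v.
Proof.
move=> hT h'T /graph_subP h'E h'h.
have hw : h' w != h w.
  apply: contraNneq h'T => hw; rewrite (_ : h' = h) //; apply/ffunP=> x.
  by have [->|/h'h] := eqVneq x w.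
have [v0 v0E] := cell_surj (h'E w); exists v0.
have facetE : v0 |: ~: verts (graph h :|: graph h') = ~: verts (graph h).
  apply/setP=> v; rewrite !inE negb_or !in_graph -(inj_eq cell_inj) v0E.
  case: (cell v) => x y; rewrite xpair_eqE /=.
  have [->|/h'h->] := eqVneq x w; last by rewrite andbb.
  by case: (y =P h' w) => [->|_]; rewrite ?hw // andbT.
split.
- by rewrite !inE negbK v0E !in_graph eqxx orbT.
- by rewrite facetE; apply/faceP; exists h => // v; rewrite !inE.
move=> G /faceP[g gT gG] sG; rewrite facetE.
suff -> : h = g by apply/subsetP=> v /gG; rewrite !inE.
have g_hh' x : (g x == h x) || (g x == h' x).
  have /graph_subP/(_ x)/cell_surj[v vE] := tableaux_in_E gT.
  apply: contraT => nhh'; have /(subsetP sG)/gG : v \in ~: verts (graph h :|: graph h').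
    by rewrite !inE vE !in_graph.
  by rewrite vE in_graph eqxx.
have g_off x : x != w -> g x = h x.
  by move=> xw; have := g_hh' x; rewrite h'h // orbb => /eqP.
apply/ffunP=> x; have [->|/g_off->//] := eqVneq x w.
have /orP[/eqP->//|/eqP gw] := g_hh' w; case/negP: h'T; rewrite (_ : h' = g) //.
by apply/ffunP=> u; have [->//|uw] := eqVneq u w; rewrite g_off ?h'h.
Qed.

Lemma link_euler_not_interior (R : realType) H : is_ball_or_sphere R Delta ->
  ~~ interior_tableau (cells H) -> link_euler Delta (~: H) = 0.
Proof.
move=> ball_or_sphere not_int.
have [/face_complP[f fT]|not_face] := boolP (~: H \in Delta); last first.
  rewrite /link_euler big_pred0 // => G; apply: contraNF not_face => /andP[GD].
  exact: tableau_complex_simplicial.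
rewrite setCK => fH; have /graph_subP fH' := fH.
have [g gH gT] : exists2 g, graph g \subset cells H & g \notin T.
  move: not_int; rewrite /interior_tableau /row_full cells_sub /= negb_and.
  case/orP=> [/forallPn[x]|/forallPn[g]].
    by rewrite negbK => /eqP/setP/(_ (f x)); rewrite !inE fH'.
  by rewrite negb_imply => /andP[gH gT]; exists g.
have [h [h' [w [hT h'T hH h'H h'h]]]] := adjacent_tableaux fT gT fH gH.
have [v free] := adjacent_free_face hT h'T (subset_trans h'H (cells_sub H)) h'h.
apply: (free_face_link_euler tableau_complex_simplicial ball_or_sphere free).
rewrite setCS -cellsS vertsK ?subUset ?hH //.
by rewrite (tableaux_in_E hT) (subset_trans h'H (cells_sub H)).
Qed.

End TableauComplex.

Theorem theorem4p3 (R : realType) (k : fieldType) (X Y : finType)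
    (T : {set {ffun X -> Y}}) (E : {set X * Y})
    (hE : forall f, f \in T -> graph f \subset E)
    (hD : is_ball_or_sphere R (tableau_complex T E))
    (K : polyring int (vertex E)) :
  is_K_polynomial (stanley_reisner_ideal (k := k) (tableau_complex T E)) K <->
  K = \sum_(F : {set X * Y} | [&& F \subset E,
                               [forall x, entries F x != set0]
                             & [forall f : {ffun X -> Y},
                                  (graph f \subset F) ==> (f \in T)]])
        (-1) ^+ (\sum_(x : X) #|entries F x| - #|X|)%N *
        \prod_(x : X) \prod_(y in entries F x) (1 - tvar E (x, y)).
Proof.
rewrite (K_polynomialP k (tableau_complex_simplicial hE)).
suff -> : \sum_(H : {set vertex E}) (\prod_(v in H) (1 - var int v))
      *~ link_euler (tableau_complex T E) (~: H) =
    \sum_(F | interior_tableau T E F) (-1) ^+ (\sum_(x : X) #|entries F x| - #|X|)%N *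
      \prod_(x : X) \prod_(y in entries F x) (1 - tvar E (x, y)) by [].
rewrite [RHS](reindex_onto (@cells _ _ E) (@verts _ _ E)) /=; last first.
  by move=> F /and3P[FE _ _]; apply: vertsK.
rewrite [RHS]big_mkcond /=; apply: eq_bigr => H _; rewrite cellsK eqxx andbT.
case: ifPn => [intH|]; last by move/(link_euler_not_interior hE hD) ->; rewrite mulr0z.
rewrite (link_euler_interior hE intH) -mulrzl rmorph_sign sum_card_entries.
rewrite (prod_entries _ (fun e => 1 - tvar E e)) big_imset /= => [|u v _ _]; last exact: cell_inj.
by congr (_ * _); apply: eq_bigr => v _; rewrite tvar_cell.
Qed.
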